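(* Let $R$ be a $d$-dimensional algebra over some field $F$, and let $A \subset R$ be a finite non-empty set with $|A+A| \leq K|A|$ and $|A \cdot A| \leq K|A|$ for some $K \geq 1$. Suppose that the characteristic of $F$ is either zero, or is sufficiently large depending on $d$. Then one of the following holds: (i) There exists a linear subspace $V \subset R$ such that every element of $V$ is a zero divisor, and such that $|A \cap (x+V)| \gg_d K^{-O_d(1)} |A|$ for some $x \in R$. (ii) There exist a subset $A'$ of $A$ of cardinality $|A'| \gg K^{-O(1)} |A|$, a finite ring $R_0$, an automorphism $\phi: R_0 \to R_0$, and embeddings (injective maps) $\iota_n: \langle (A')^n \rangle \to R_0 \cdot t^n \subset R_0[t]_\phi$ for $n \geq 1$ which are additive homomorphisms, and such that $\iota_{n+m}(a_n a_m) = \iota_n(a_n) \iota_m(a_m)$ for all $n,m \geq 1$ and all $a_n \in \langle (A')^n \rangle$, $a_m \in \langle (A')^m \rangle$.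
   Context: Rings and algebras are associative, but need not be commutative and need not contain a multiplicative identity. For subsets $A,B$ of a ring $R$: $A+B := \{a+b : a\in A, b\in B\}$, $A\cdot B := \{ab : a\in A, b\in B\}$, $x + A := \{x+a : a \in A\}$, and $A^n := A\cdot\ldots\cdot A$ ($n$ factors) is the set of all products $a_1\cdots a_n$ with $a_i\in A$; $\langle A^n\rangle$ is the additive subgroup of $R$ generated by $A^n$. $|A|$ denotes the cardinality of a finite set $A$. $R^*$ denotes the set of non-zero-divisors of $R$, i.e. the elements $r \in R$ such that $ra \neq 0$ and $ar \neq 0$ whenever $a\in R$, $a \neq 0$; a zero divisor is an element of $R\setminus R^*$ (so $0$ counts as a zero divisor when $R\neq\{0\}$). The twisted polynomial ring $R_0[t]_\phi$ is the ring generated by $R_0$ and a formal variable $t$ subject to the relations $ta = \phi(a)t$ for $a\in R_0$; concretely, it consists of formal sums $\sum_{n=0}^d a_n t^n$ with $a_n \in R_0$, $d \geq 0$, added coefficientwise and multiplied via $(a t^n)(b t^m) = a\,\phi^n(b)\, t^{n+m}$. Its degree $n$ component is $R_0\cdot t^n = \{ a t^n : a \in R_0\}$. $X \gg Y$ means $Y \leq CX$ for some absolute constant $C$, and $O(1)$ denotes a quantity bounded by an absolute constant; a subscript $d$ (as in $\gg_d$, $O_d(1)$) means that the implied constants are allowed to depend on $d$ (but not on $R$, $F$, $A$, $K$). *)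

(* Defs.v *)
From HB Require Import structures.
From mathcomp Require Import all_boot all_order all_algebra finmap.
From mathcomp Require Import boolp classical_sets reals.
From mathcomp.multinomials Require Import monalg.

Set Implicit Arguments.
Unset Strict Implicit.
Unset Printing Implicit Defensive.

Import GRing.Theory.
Local Open Scope fset_scope.
Local Open Scope ring_scope.

Reserved Notation "x ** y" (at level 40, left associativity).

(* Associative rings, not assumed commutative and without a (required) unit;
   the ring structures of MathComp all contain a unit. *)
HB.mixin Record Zmodule_isRng R of GRing.Zmodule R := {
  rngmul : R -> R -> R;
  rngmulA : associative rngmul;
  rngmulDl : left_distributive rngmul +%R;
  rngmulDr : right_distributive rngmul +%R
}.

#[short(type="rngType")]
HB.structure Definition Rng := {R of GRing.Zmodule R & Zmodule_isRng R}.

#[short(type="finRngType")]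
HB.structure Definition FinRng := {R of Rng R & Finite R}.

Notation "x ** y" := (rngmul x y) : ring_scope.

HB.mixin Record Rng_isAlgebra (F : fieldType) R of Rng R & Vector F R := {
  rngscaleAl : forall (k : F) (x y : R), k *: (x ** y) = (k *: x) ** y;
  rngscaleAr : forall (k : F) (x y : R), k *: (x ** y) = x ** (k *: y)
}.

#[short(type="fdAlgebraType")]
HB.structure Definition FdAlgebra (F : fieldType) :=
  {R of Rng R & Vector F R & Rng_isAlgebra F R}.

Section RngTheory.
Variable R : rngType.
Implicit Types x y : R.

Lemma rngmul0l x : 0 ** x = 0.
Proof. by apply: (addrI (0 ** x)); rewrite -rngmulDl !addr0. Qed.

Lemma rngmul0r x : x ** 0 = 0.
Proof. by apply: (addrI (x ** 0)); rewrite -rngmulDr !addr0. Qed.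

End RngTheory.

Section Subsets.
Variable R : rngType.
Implicit Types A B : {fset R}.

Definition non_zero_divisor (r : R) : Prop :=
  forall a : R, a != 0 -> r ** a != 0 /\ a ** r != 0.

Definition zero_divisor (r : R) : Prop := ~ non_zero_divisor r.

Definition sumset A B : {fset R} := [fset a + b | a in A, b in B].

Definition prodset A B : {fset R} := [fset a ** b | a in A, b in B].

(* The n-fold product set A * ... * A, meaningful for n >= 1 only (R need not
   have a unit); the junk value at n = 0 is A. *)
Definition powset A (n : nat) : {fset R} := iter n.-1 (fun B => prodset B A) A.

Definition additive_subgroup : set (set R) :=
  [set H : set R | H 0 /\ forall x y, H x -> H y -> H (x - y)].

(* The additive subgroup generated by the set A^n. *)
Definition span_pow A (n : nat) : set R :=
  smallest additive_subgroup [set x | x \in powset A n].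

End Subsets.

Record rngAut (R : rngType) := RngAut {
  rngaut :> R -> R;
  rngaut_bij : bijective rngaut;
  rngautD : {morph rngaut : x y / x + y};
  rngautM : {morph rngaut : x y / x ** y}
}.

Section IterAut.
Variables (R : rngType) (phi : rngAut R).

Lemma iter_autD n : {morph iter n phi : x y / x + y}.
Proof. by elim: n => // n IH x y; rewrite !iterS IH rngautD. Qed.

Lemma iter_autM n : {morph iter n phi : x y / x ** y}.
Proof. by elim: n => // n IH x y; rewrite !iterS IH rngautM. Qed.

Lemma iter_aut0 n : iter n phi 0 = 0.
Proof. by apply: (addrI (iter n phi 0)); rewrite -iter_autD !addr0. Qed.

End IterAut.

(* The twisted polynomial ring R[t]_phi: the finitely supported families of
   coefficients (a_n)_(n : nat) in R, with [<< a *g n >>] standing for a t^n. *)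
Definition twpoly (R : rngType) (phi : rngAut R) : Type := {malg R[nat]}.

Section TwistedPolynomials.
Variables (R : rngType) (phi : rngAut R).

HB.instance Definition _ := GRing.Zmodule.on (twpoly phi).

Implicit Types f g h : twpoly phi.

Definition twmonom (n : nat) (a : R) : twpoly phi := << a *g n >>.

Lemma twmonomD n a b : twmonom n (a + b) = twmonom n a + twmonom n b.
Proof. exact: monalgUD. Qed.

Lemma twmonom0 n : twmonom n 0 = 0.
Proof. exact: monalgU0. Qed.

(* (a t^n) (b t^m) = a phi^n(b) t^(n + m), extended biadditively. *)
Definition twmul f g : twpoly phi :=
  \sum_(n <- msupp f) \sum_(m <- msupp g)
    twmonom (n + m) (f@_n ** iter n phi g@_m).

Lemma twmulEw (d1 d2 : {fset nat}) f g :
  msupp f `<=` d1 -> msupp g `<=` d2 ->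
  twmul f g = \sum_(n <- d1) \sum_(m <- d2)
    twmonom (n + m) (f@_n ** iter n phi g@_m).
Proof.
move=> le1 le2; rewrite /twmul (big_fset_incl _ le1) /=.
  apply/eq_bigr=> n _; apply/big_fset_incl => // m _ /mcoeff_outdom ->.
  by rewrite iter_aut0 rngmul0r twmonom0.
move=> n _ /mcoeff_outdom fn0.
by rewrite big1 // => m _; rewrite fn0 rngmul0l twmonom0.
Qed.

Lemma twmulUU n m a b :
  twmul (twmonom n a) (twmonom m b) = twmonom (n + m) (a ** iter n phi b).
Proof. by rewrite (twmulEw msuppU_le msuppU_le) !big_seq_fset1 !mcoeffUU. Qed.

Lemma twmulDl : left_distributive twmul +%R.
Proof.
move=> f g h.
rewrite [in RHS](twmulEw (fsubsetUl _ (msupp g)) (fsubset_refl _)).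
rewrite [in RHS](twmulEw (fsubsetUr (msupp f) _) (fsubset_refl _)).
rewrite (twmulEw (msuppD_le _ _) (fsubset_refl _)).
rewrite -big_split /=; apply/eq_bigr => n _.
rewrite -big_split /=; apply/eq_bigr => m _.
by rewrite mcoeffD rngmulDl twmonomD.
Qed.

Lemma twmulDr : right_distributive twmul +%R.
Proof.
move=> f g h.
rewrite [in RHS](twmulEw (fsubset_refl _) (fsubsetUl _ (msupp h))).
rewrite [in RHS](twmulEw (fsubset_refl _) (fsubsetUr (msupp g) _)).
rewrite (twmulEw (fsubset_refl _) (msuppD_le _ _)).
rewrite -big_split /=; apply/eq_bigr => n _.
rewrite -big_split /=; apply/eq_bigr => m _.
by rewrite mcoeffD iter_autD rngmulDr twmonomD.
Qed.

Lemma twmul0l f : twmul 0 f = 0.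
Proof. by apply: (addrI (twmul 0 f)); rewrite -twmulDl !addr0. Qed.

Lemma twmul0r f : twmul f 0 = 0.
Proof. by apply: (addrI (twmul f 0)); rewrite -twmulDr !addr0. Qed.

Lemma twpolyE f : f = \sum_(n <- msupp f) twmonom n f@_n.
Proof. exact: monalgE. Qed.

Lemma twmulA : associative twmul.
Proof.
move=> f g h; rewrite [f]twpolyE [g]twpolyE [h]twpolyE.
have suml (I : Type) (s : seq I) (F : I -> twpoly phi) k :
  twmul (\sum_(i <- s) F i) k = \sum_(i <- s) twmul (F i) k.
  exact: (big_morph (twmul^~ k) (fun x y => twmulDl x y k) (twmul0l k)).
have sumr (I : Type) (s : seq I) (F : I -> twpoly phi) k :
  twmul k (\sum_(i <- s) F i) = \sum_(i <- s) twmul k (F i).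
  exact: (big_morph (twmul k) (fun x y => twmulDr k x y) (twmul0r k)).
rewrite !suml; apply: eq_bigr => i _.
rewrite !(sumr _ _ _ (twmonom i _)) suml; apply: eq_bigr => j _.
rewrite !sumr; apply: eq_bigr => k _.
by rewrite !twmulUU iter_autM rngmulA addnA iterD.
Qed.

HB.instance Definition _ :=
  Zmodule_isRng.Build (twpoly phi) twmulA twmulDl twmulDr.

Definition twcomponent (n : nat) : set (twpoly phi) :=
  [set twmonom n a | a in setT].

End TwistedPolynomials.

Arguments twcomponent {R} phi n.

(* The maps iota n are total functions on R of which only the restrictions to
   the groups <A^n>, n >= 1, matter. *)
Record graded_embedding (R : rngType) (A : {fset R})
    (R0 : rngType) (phi : rngAut R0) (iota : nat -> R -> twpoly phi) : Prop := {
  graded_embedding_component : forall n x, (1 <= n)%N ->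
    span_pow A n x -> twcomponent phi n (iota n x);
  graded_embedding_inj : forall n x y, (1 <= n)%N ->
    span_pow A n x -> span_pow A n y -> iota n x = iota n y -> x = y;
  graded_embeddingD : forall n x y, (1 <= n)%N ->
    span_pow A n x -> span_pow A n y -> iota n (x + y) = iota n x + iota n y;
  graded_embeddingM : forall n m x y, (1 <= n)%N -> (1 <= m)%N ->
    span_pow A n x -> span_pow A m y ->
    iota (n + m)%N (x ** y) = iota n x ** iota m y
}.

(* Main.v *)
From HB Require Import structures.
Require Import Defs.
From mathcomp Require Import all_boot all_order all_algebra finmap.
From mathcomp Require Import boolp classical_sets reals.
From mathcomp Require Import perm zify ring lra.
From mathcomp.multinomials Require monalg.

(* If enough elements of A, or enough differences of elements of A, are zero
   divisors, then a positive proportion B of a translate of A lies in the zero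
   set of N x = det(y |-> x y) det(y |-> y x), a polynomial of degree 2 dim R.
   Restrict B to an affine subspace x + W of minimal dimension still containing
   a large part of it. Then no proper affine subspace contains a positive
   proportion of B, and differencing N along popular differences of B, which
   must span W, shows that the iterated differences of N of order 2 dim R vanish
   on W. As they recover (2 dim R)! N(v), all of W consists of zero divisors
   once the characteristic exceeds 2 dim R.

   Otherwise R is unital and most differences are invertible. By Cauchy-Schwarz
   there are a unit b in A and a large A' in A such that b^-1 A' lies in the set
   S_M of the x with |x A - A| <= M |A|. An element x of S_M satisfies
   x (p - q) = r - s for some p, q, r, s in A' with p - q invertible, since
   otherwise (p, q) |-> x p - q would have too few collisions on A' x A'. Hence
   b^-1 x b is a quotient of elements of b^-1 A' - b^-1 A', and lies in S_M0 for
   an M0 independent of M. By finiteness S_M does not depend on M in a long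
   range, so it is a finite ring R0 normalised by b, and A' is contained in
   R0 b: then t |-> b identifies the spans of the A'^n with subsets of R0 t^n. *)

Set Implicit Arguments.
Unset Strict Implicit.
Unset Printing Implicit Defensive.

Import Order.TTheory GRing.Theory Num.Theory.
Local Open Scope fset_scope.
Local Open Scope ring_scope.

(** * Counting in finite sets *)

Section Counting1.
Variable T : choiceType.
Implicit Types A : {fset T}.
Local Open Scope nat_scope.

Lemma card_fset_sep A (P : pred T) :
  #|` [fset x in A | P x]| = \sum_(x <- A) P x.
Proof. by rewrite card_fset_sum1 big_fset big_mkcond. Qed.

Lemma leq_sum_fset A (f g : T -> nat) :
  (forall x, x \in A -> f x <= g x) -> \sum_(x <- A) f x <= \sum_(x <- A) g x.
Proof. by move=> fg; rewrite !big_seq; apply: leq_sum. Qed.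

Lemma leq_sum_fsetS A A' (f : T -> nat) :
  A `<=` A' -> \sum_(x <- A) f x <= \sum_(x <- A') f x.
Proof.
move=> AA'; rewrite [leqRHS](big_fsetID _ (mem A)) /=.
have -> : [fset x in A' | x \in A] = A.
  apply/fsetP => x; rewrite !inE; apply: andb_idl; exact: (fsubsetP AA').
exact: leq_addr.
Qed.

Lemma sum_fset_const A n : \sum_(x <- A) n = #|` A| * n.
Proof. by rewrite big_const_seq count_predT iter_addn_0 mulnC. Qed.

Lemma exists_ge_average A (f : T -> nat) m :
  A != fset0 -> #|` A| * m <= \sum_(x <- A) f x ->
  exists2 x, x \in A & m <= f x.
Proof.
move=> /fset0Pn[a aA] le_m; apply: contrapT => no_x.
have lt_f x : x \in A -> f x < m.
  by move=> xA; rewrite ltnNge; apply/negP => mx; apply: no_x; exists x.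
have: \sum_(x <- A) (f x).+1 <= \sum_(x <- A) m by exact: leq_sum_fset.
under eq_bigr => x _ do rewrite -addn1.
rewrite big_split /= !sum_fset_const muln1.
have : 0 < #|` A| by rewrite cardfs_gt0; apply/fset0Pn; exists a.
lia.
Qed.

Lemma cauchy_schwarz_nat A (r : T -> nat) :
  (\sum_(x <- A) r x) ^ 2 <= #|` A| * \sum_(x <- A) r x ^ 2.
Proof.
have e2 : #|` A| * (\sum_(x <- A) r x ^ 2) =
          \sum_(x <- A) \sum_(y <- A) r y ^ 2 by rewrite sum_fset_const.
have e1 : #|` A| * (\sum_(x <- A) r x ^ 2) =
          \sum_(x <- A) \sum_(y <- A) r x ^ 2.
  by rewrite big_distrr /=; apply: eq_bigr => x _; rewrite sum_fset_const.
rewrite -(leq_pmul2l (isT : 0 < 2)) [X in _ <= X]mul2n -addnn {1}e1 e2 -big_split /=.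
rewrite -mulnn big_distrlr /= big_distrr /=.
apply: leq_sum => x _; rewrite big_distrr -big_split /=.
by apply: leq_sum => y _; rewrite (nat_Cauchy (r x) (r y)).
Qed.

End Counting1.

Section Counting.
Variables T T' : choiceType.
Implicit Types (A : {fset T}) (B : {fset T'}).
Local Open Scope nat_scope.

Lemma leq_card_fset_inj A B (f : T -> T') :
  {in A &, injective f} -> (forall x, x \in A -> f x \in B) -> #|` A| <= #|` B|.
Proof.
move=> f_inj fAB; rewrite -(card_in_imfset imfset_key f_inj) /=.
by apply/fsubset_leq_card/fsubsetP => _ /imfsetP[x /= xA ->]; exact: fAB.
Qed.

Lemma leq_card_fset_surj A B (f : T -> T') :
  (forall y, y \in B -> exists2 x, x \in A & y = f x) -> #|` B| <= #|` A|.
Proof.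
move=> fAB; apply: (@leq_trans #|` [fset f x | x in A]|); last first.
  exact: leq_imfset_card.
apply/fsubset_leq_card/fsubsetP => y /fAB[x xA ->].
by apply/imfsetP; exists x.
Qed.

Lemma sum_fsetX A B (f : T * T' -> nat) :
  \sum_(p <- A `*` B) f p = \sum_(x <- A) \sum_(y <- B) f (x, y).
Proof. by rewrite big_imfset2 //= => -[a b] [c d] _ _ /= [-> ->]. Qed.

Lemma card_fsetX A B : #|` A `*` B| = #|` A| * #|` B|.
Proof.
rewrite card_fset_sum1 sum_fsetX -sum_fset_const.
by apply: eq_bigr => x _; rewrite sum_fset_const muln1.
Qed.

End Counting.

(** The sum on the right counts the pairs of [A] with equal images. It is the sum of the squared
    fibre sizes, which Cauchy-Schwarz bounds from below. *)
Lemma collisions (T T' : choiceType) (A : {fset T}) (B : {fset T'})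
    (f : T -> T') :
  (forall x, x \in A -> f x \in B) ->
  (#|` A| ^ 2 <= #|` B| * \sum_(x <- A) #|` [fset y in A | f y == f x]|)%N.
Proof.
move=> fAB; pose r z := #|` [fset y in A | f y == z]|.
have expand (g : T' -> nat) :
    (\sum_(x <- A) g (f x) = \sum_(z <- B) \sum_(x <- A) (f x == z) * g z)%N.
  rewrite exchange_big /= !big_seq; apply: eq_bigr => x xA.
  rewrite (big_fsetD1 (f x)) /=; last exact: fAB.
  rewrite eqxx mul1n big_seq big1 ?addn0 // => z.
  by rewrite !inE eq_sym => /andP[/negPf->].
have -> : #|` A| = (\sum_(z <- B) r z)%N.
  rewrite card_fset_sum1 (expand (fun=> 1)%N); apply: eq_bigr => z _.
  by rewrite /r card_fset_sep; apply: eq_bigr => x _; rewrite muln1.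
apply: leq_trans (cauchy_schwarz_nat _ _) _; rewrite leq_mul2l; apply/orP; right.
rewrite (expand r); apply: eq_leq; apply: eq_bigr => z _.
by rewrite -big_distrl -card_fset_sep /= -mulnn.
Qed.

(** * Sumsets *)

Reserved Notation "A :+: B" (at level 50, left associativity).
Reserved Notation "A :-: B" (at level 50, left associativity).

Section Sumsets.
Variable V : zmodType.
Implicit Types A B C X Y Z : {fset V}.

Definition addfs A B : {fset V} := [fset a + b | a in A, b in B].
Definition subfs A B : {fset V} := [fset a - b | a in A, b in B].

Local Notation "A :+: B" := (addfs A B).
Local Notation "A :-: B" := (subfs A B).

Lemma addfsP A B z :
  reflect (exists a b, [/\ a \in A, b \in B & z = a + b]) (z \in A :+: B).
Proof.
apply: (iffP (imfset2P _ _ _ _ _)) => [[a /= aA [b /= bB ->]]|[a [b [aA bB ->]]]].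
  by exists a, b.
by exists a => //; exists b.
Qed.

Lemma subfsP A B z :
  reflect (exists a b, [/\ a \in A, b \in B & z = a - b]) (z \in A :-: B).
Proof.
apply: (iffP (imfset2P _ _ _ _ _)) => [[a /= aA [b /= bB ->]]|[a [b [aA bB ->]]]].
  by exists a, b.
by exists a => //; exists b.
Qed.

Lemma mem_addfs A B a b : a \in A -> b \in B -> a + b \in A :+: B.
Proof. by move=> aA bB; apply/addfsP; exists a, b. Qed.

Lemma mem_subfs A B a b : a \in A -> b \in B -> a - b \in A :-: B.
Proof. by move=> aA bB; apply/subfsP; exists a, b. Qed.

Lemma card_addfs A B : (#|` A :+: B| <= #|` A| * #|` B|)%N.
Proof.
rewrite -card_fsetX.
apply: (@leq_card_fset_surj _ _ _ _ (fun p => p.1 + p.2)) => z.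
by move=> /addfsP[a [b [aA bB ->]]]; exists (a, b); rewrite // !inE aA.
Qed.

Lemma card_subfs A B : (#|` A :-: B| <= #|` A| * #|` B|)%N.
Proof.
rewrite -card_fsetX.
apply: (@leq_card_fset_surj _ _ _ _ (fun p => p.1 - p.2)) => z.
by move=> /subfsP[a [b [aA bB ->]]]; exists (a, b); rewrite // !inE aA.
Qed.

Lemma addfsC A B : A :+: B = B :+: A.
Proof.
by apply/fsetP => z; apply/addfsP/addfsP => -[a [b [aA bB ->]]];
  exists b, a; rewrite addrC.
Qed.

Lemma addfsA A B C : A :+: (B :+: C) = A :+: B :+: C.
Proof.
apply/fsetP => z; apply/addfsP/addfsP.
  move=> [a [_ [aA /addfsP[b [c [bB cC ->]]] ->]]].
  by exists (a + b), c; rewrite addrA mem_addfs.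
move=> [_ [c [/addfsP[a [b [aA bB ->]]] cC ->]]].
by exists a, (b + c); rewrite addrA mem_addfs.
Qed.

Lemma addfsAC A B C : A :+: B :+: C = A :+: C :+: B.
Proof. by rewrite -!addfsA (addfsC B). Qed.

Lemma subfsS A B C D : A `<=` C -> B `<=` D -> A :-: B `<=` C :-: D.
Proof.
move=> /fsubsetP AC /fsubsetP BD; apply/fsubsetP => z /subfsP[a [b [aA bB ->]]].
by rewrite mem_subfs ?AC ?BD.
Qed.

Lemma addfsS A B C D : A `<=` C -> B `<=` D -> A :+: B `<=` C :+: D.
Proof.
move=> /fsubsetP AC /fsubsetP BD; apply/fsubsetP => z /addfsP[a [b [aA bB ->]]].
by rewrite mem_addfs ?AC ?BD.
Qed.

Lemma card_translate A c : #|` A :+: [fset c]| = #|` A|.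
Proof.
apply/eqP; rewrite eqn_leq; apply/andP; split.
  by rewrite -[leqRHS]muln1 -(cardfs1 c) card_addfs.
apply: (@leq_card_fset_inj _ _ _ _ (+%R^~ c)) => [x y _ _|x xA].
  exact: addIr.
by rewrite mem_addfs ?inE.
Qed.

Lemma card_subfsC A B : #|` A :-: B| = #|` B :-: A|.
Proof.
wlog suff : A B / (#|` A :-: B| <= #|` B :-: A|)%N.
  by move=> le; apply/eqP; rewrite eqn_leq !le.
apply: (@leq_card_fset_inj _ _ _ _ -%R) => [x y _ _|_ /subfsP[a [b [aA bB ->]]]].
  exact: oppr_inj.
by rewrite opprB mem_subfs.
Qed.

(* Ruzsa's triangle inequality: [v - w = (u - w) - (u - v)]. *)
Lemma ruzsa_triangle A B C :
  (#|` A| * #|` B :-: C| <= #|` A :-: B| * #|` A :-: C|)%N.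
Proof.
have [rep repP] : exists rep : V -> V * V, forall z, z \in B :-: C ->
    [/\ (rep z).1 \in B, (rep z).2 \in C & (rep z).1 - (rep z).2 = z].
  have /choice[rep repP] z : exists p : V * V, z \in B :-: C ->
      [/\ p.1 \in B, p.2 \in C & p.1 - p.2 = z].
    have [/subfsP[b [c [bB cC ->]]]|_] := boolP (z \in B :-: C).
      by exists (b, c).
    by exists (0, 0).
  by exists rep.
rewrite -!card_fsetX.
pose f (p : V * V) := (p.1 - (rep p.2).1, p.1 - (rep p.2).2).
apply: (@leq_card_fset_inj _ _ _ _ f) => [[a z] [a' z']|[a z]]; last first.
  by rewrite !inE /= => /andP[aA /repP[? ? _]]; rewrite !mem_subfs.
rewrite !inE /= => /andP[aA /repP[_ _ ez]] /andP[aA' /repP[_ _ ez']] [e1 e2].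
have ezz : z = z'.
  have subE (x y w : V) : x - y = (w - y) - (w - x).
    by rewrite opprB [RHS]addrC addrA subrK.
  by rewrite -ez -ez' (subE _ _ a) e1 e2 -subE.
by congr pair => //; move: e1; rewrite ezz => /addIr.
Qed.

(** This is the difference version applied to [- A], as [- A - B] is the negative of [A + B]. *)
Lemma ruzsa_triangle_add A B C :
  (#|` A| * #|` B :-: C| <= #|` A :+: B| * #|` A :+: C|)%N.
Proof.
pose opp X := [fset - x | x in X].
have memN X x : (- x \in opp X) = (x \in X).
  by rewrite mem_imfset //; exact: oppr_inj.
have card_opp X : #|` opp X| = #|` X|.
  by rewrite card_imfset //; exact: oppr_inj.
have opp_sub X Y : #|` opp X :-: Y| = #|` X :+: Y|.
  rewrite -(card_opp (X :+: Y)); congr (#|` _|); apply/fsetP => z.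
  rewrite -[z]opprK memN; apply/subfsP/addfsP.
    move=> [_ [b [/imfsetP[a /= aX ->] bY /eqP]]].
    by rewrite -opprD eqr_opp => /eqP->; exists a, b.
  by move=> [a [b [aX bY ->]]]; exists (- a), b; rewrite memN opprD.
by rewrite -(card_opp A) -!opp_sub ruzsa_triangle.
Qed.

(* Ruzsa's covering lemma: [T] is a maximal subset of [X] whose translates of
   [- A] are disjoint. *)
Lemma ruzsa_covering X A :
  A != fset0 -> exists2 T, (#|` T| * #|` A| <= #|` X :-: A|)%N &
    T `<=` X /\ X `<=` T :+: (A :-: A).
Proof.
move=> A0; suff [T [TX TA XT]] : exists T, [/\ T `<=` X,
    (#|` T| * #|` A| <= #|` T :-: A|)%N & X `<=` T :+: (A :-: A)].
  exists T => //; apply: leq_trans TA _.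
  by apply/fsubset_leq_card/subfsS.
(* [T] grows greedily: a new [x] joins it only if it lies outside [T + (A - A)], that is, if [x - A]
   is disjoint from [T - A]. *)
elim/fset1U_rect: X => [|x X xX [T [TX TA XT]]].
  by exists fset0; rewrite cardfs0 mul0n !fsub0set.
have [xT|xT] := boolP (x \in T :+: (A :-: A)).
  exists T; split => //; first exact: fsubset_trans TX (fsubsetUr _ _).
  by rewrite fsubUset fsub1set xT.
have [a0 a0A] := fset0Pn _ A0.
exists (x |` T); split; first exact: fsetUS.
  have xnT : x \notin T.
    by apply: contraNN xX => /(fsubsetP TX).
  rewrite cardfsU1 xnT /= mulnDl mul1n.
  apply: (@leq_trans (#|` [fset x] :-: A| + #|` T :-: A|)).
    rewrite leq_add //.
    apply: (@leq_card_fset_inj _ _ _ _ (fun a => x - a)) => [a b _ _|a aA].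
      by move=> /addrI /oppr_inj.
    by rewrite mem_subfs ?inE.
  rewrite -cardfsUI.
  suff -> : ([fset x] :-: A) `&` (T :-: A) = fset0.
    rewrite cardfs0 addn0; apply/fsubset_leq_card; rewrite fsubUset.
    by rewrite !subfsS ?fsubset_refl ?fsubsetUl ?fsubsetUr.
  apply/fsetP => z; rewrite !inE; apply/negbTE/negP => /andP[].
  move=> /subfsP[x' [a [/[!inE]/eqP-> aA ->]]] /subfsP[t [b [tT bA e]]].
  case/negP: xT; have -> : x = t + (a - b).
    by rewrite addrCA addrC -e subrK.
  by rewrite mem_addfs ?mem_subfs.
rewrite fsubUset fsub1set; apply/andP; split.
  by rewrite -[X in X \in _]addr0 -(subrr a0) mem_addfs ?mem_subfs ?fset1U1.
by apply: fsubset_trans XT _; rewrite addfsS ?fsubset_refl ?fsubsetUr.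
Qed.

End Sumsets.

Notation "A :+: B" := (addfs A B) : fset_scope.
Notation "A :-: B" := (subfs A B) : fset_scope.

#[local] Hint Resolve fsubset_refl : core.

(** * The Plünnecke-Ruzsa inequality *)

Section Plunnecke.
Variable V : zmodType.
Implicit Types A B C X Z : {fset V}.

(* Petridis' lemma, by induction on [C]: passing from [C] to [c |` C] adds to
   [X + A + C] at most the part of [X + A + c] outside [Z + A + c], where [Z] is
   the set of the [x] in [X] such that [x + A + c] lies in [X + A + C]. *)
Lemma petridis X A :
  (forall Z, Z `<=` X -> #|` X :+: A| * #|` Z| <= #|` Z :+: A| * #|` X|)%N ->
  forall C, (#|` X :+: A :+: C| * #|` X| <= #|` X :+: A| * #|` X :+: C|)%N.
Proof.
move=> Xmin; elim/fset1U_rect => [|c C cC IH].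
  suff -> : X :+: A :+: fset0 = fset0 by rewrite cardfs0.
  by apply/fsetP => z; rewrite inE; apply/negP => /addfsP[a [b []]].
pose Z := [fset x in X | [fset x] :+: A :+: [fset c] `<=` X :+: A :+: C].
have ZX : Z `<=` X by apply/fsubsetP => x; rewrite !inE => /andP[].
have ZAC : Z :+: A :+: [fset c] `<=` X :+: A :+: C.
  apply/fsubsetP => _ /addfsP[_ [_ [/addfsP[x [a [xZ aA ->]]] /[!inE]/eqP-> ->]]].
  move: xZ; rewrite !inE => /andP[_ /fsubsetP]; apply.
  by rewrite !mem_addfs ?inE.
have le1 : (#|` X :+: A :+: (c |` C)| + #|` Z :+: A| <=
            #|` X :+: A :+: C| + #|` X :+: A|)%N.
  rewrite -(card_translate (X :+: A) c) -(card_translate (Z :+: A) c).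
  set W := Z :+: A :+: [fset c]; set U := X :+: A :+: [fset c].
  have WU : W `<=` U by apply: addfsS => //; apply: addfsS.
  suff : (#|` X :+: A :+: (c |` C)| <= #|` (X :+: A :+: C) `|` (U `\` W)|)%N.
    by rewrite cardfsU cardfsDS //; have := fsubset_leq_card WU; lia.
  apply/fsubset_leq_card/fsubsetP => _ /addfsP[x [d [xXA dC ->]]].
  move: dC; rewrite 2!inE => /orP[/eqP->|dC]; last by rewrite inE mem_addfs.
  rewrite in_fsetU in_fsetD.
  have -> : x + c \in U by rewrite mem_addfs ?inE.
  by rewrite andbT; case: (boolP (_ \in W)) => [/(fsubsetP ZAC)->|]; rewrite ?orbT.
have le2 : (#|` X :+: C| + #|` X| <= #|` X :+: (c |` C)| + #|` Z|)%N.
  suff : (#|` X :+: C| + #|` (X `\` Z) :+: [fset c]| <= #|` X :+: (c |` C)|)%N.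
    by rewrite card_translate cardfsDS //; have := fsubset_leq_card ZX; lia.
  rewrite -cardfsUI.
  suff -> : (X :+: C) `&` ((X `\` Z) :+: [fset c]) = fset0.
    rewrite cardfs0 addn0; apply/fsubset_leq_card; rewrite fsubUset.
    rewrite addfsS ?fsubset_refl ?fsubsetUr //=.
    by rewrite addfsS ?fsubsetDl ?fsubsetUl.
  apply/fsetP => z; rewrite inE in_fset0; apply/negP => /andP[zXC].
  move=> /addfsP[x [d []]]; rewrite in_fsetD => /andP[xZ xX] /[!in_fset1]/eqP-> ez.
  case/negP: xZ; rewrite !inE xX /=.
  apply/fsubsetP => w /addfsP[_ [c' [/addfsP[x' [a [/[!inE]/eqP-> aA ->]]]]]].
  move=> /eqP-> ->; move: zXC; rewrite ez.
  move=> /addfsP[y [d' [yX dC e]]].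
  by rewrite addrAC e addrAC !mem_addfs.
have := Xmin _ ZX.
move: le1 le2 IH (fsubset_leq_card ZX); set a := #|` _|; set b := #|` _|.
set p := #|` _|; set q := #|` _|; set r := #|` _|; set s := #|` _|.
set t := #|` _|; set u := #|` _|; nia.
Qed.

(** A minimum of the ratio [f / g], with denominators cleared to remain in [nat]. For
    [|X + A| / |X|] it supplies the hypothesis of [petridis]. *)
Lemma exists_min_ratio (T : choiceType) (s : {fset T}) (f g : T -> nat) :
  s != fset0 -> (forall x, x \in s -> 0 < g x)%N ->
  exists2 x, x \in s & forall y, y \in s -> (f x * g y <= f y * g x)%N.
Proof.
elim/fset1U_rect: s => [|x s xs IH _ g_gt0]; first by rewrite eqxx.
have gx : (0 < g x)%N by rewrite g_gt0 ?fset1U1.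
have [s0|s0] := eqVneq (s : {fset T}) fset0.
  exists x; first by rewrite fset1U1.
  by move=> y; rewrite s0 !inE orbF => /eqP->.
have [|z zs zmin] := IH s0; first by move=> y ys; rewrite g_gt0 // !inE ys orbT.
have gz : (0 < g z)%N by rewrite g_gt0 // !inE zs orbT.
have [le_zx|lt_xz] := leqP (f z * g x) (f x * g z).
  exists z; first by rewrite !inE zs orbT.
  by move=> y; rewrite !inE => /orP[/eqP->|/zmin].
exists x; first by rewrite fset1U1.
move=> y; rewrite !inE => /orP[/eqP->//|ys].
have le_zy := zmin y ys; rewrite -(leq_pmul2l gz).
apply: (@leq_trans (f z * g x * g y)).
  by rewrite mulnA (mulnC (g z)) leq_mul2r (ltnW lt_xz) orbT.
by rewrite mulnAC mulnA (mulnC (g z)) leq_mul2r le_zy orbT.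
Qed.

(* [A + ... + A] with [n.+1] summands. *)
Definition iter_addfs A n := iter n (fun B => B :+: A) A.

(** Let [X] in [A] minimize [|X + A| / |X|], a ratio at most [K]. By [petridis] each further summand
    [A] costs at most a factor [K], and Ruzsa's triangle inequality through [X] turns the two sums
    into a difference. *)
Lemma plunnecke_ruzsa A K n m : A != fset0 ->
  (#|` A :+: A| <= K * #|` A|)%N ->
  (#|` iter_addfs A n :-: iter_addfs A m| <=
   K ^ (n.+1 + m.+1) * #|` A|)%N.
Proof.
move=> A0 KA.
have [X XP Xmin] :
    exists2 X, X \in [fset X in fpowerset A | X != fset0] &
      forall Z, Z \in [fset X in fpowerset A | X != fset0] ->
        (#|` X :+: A| * #|` Z| <= #|` Z :+: A| * #|` X|)%N.
  apply: exists_min_ratio.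
    by apply/fset0Pn; exists A; rewrite !inE fpowersetE A0 fsubset_refl.
  by move=> X; rewrite !inE cardfs_gt0 => /andP[].
have /andP[XA X0] : (X `<=` A) && (X != fset0) by move: XP; rewrite !inE fpowersetE.
have X_gt0 : (0 < #|` X|)%N by rewrite cardfs_gt0.
have A_gt0 : (0 < #|` A|)%N by rewrite cardfs_gt0.
have KX : (#|` X :+: A| <= K * #|` X|)%N.
  have := Xmin A; rewrite !inE fpowersetE fsubset_refl A0 => /(_ isT).
  move=> le_A; rewrite -(leq_pmul2r A_gt0); apply: leq_trans le_A _.
  by rewrite mulnAC leq_mul2r KA orbT.
have grow C : (#|` X :+: A :+: C| <= K * #|` X :+: C|)%N.
  rewrite -(leq_pmul2r X_gt0); apply: leq_trans (petridis _ C) _ => [Z ZX|].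
    have [->|Z0] := eqVneq Z fset0; first by rewrite cardfs0 muln0.
    by apply: Xmin; rewrite !inE fpowersetE Z0 (fsubset_trans ZX).
  by rewrite mulnAC leq_mul2r KX orbT.
have iter_le i : (#|` X :+: iter_addfs A i| <= K ^ i.+1 * #|` X|)%N.
  elim: i => [|i IH] /=; first by rewrite expn1.
  rewrite addfsA addfsAC; apply: leq_trans (grow _) _.
  by rewrite expnS -mulnA leq_mul2l IH orbT.
have := ruzsa_triangle_add X (iter_addfs A n) (iter_addfs A m).
have XA_le := fsubset_leq_card XA.
move=> /leq_trans/(_ (leq_mul (iter_le n) (iter_le m))).
rewrite mulnACA -expnD mulnA mulnC leq_pmul2r // => /leq_trans; apply.
by rewrite leq_mul2l XA_le orbT.
Qed.

End Plunnecke.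

(** * Elements almost stabilizing a set of small doubling *)

Section RngTheory.
Variable R : rngType.
Implicit Types x y : R.

Lemma rngmulNl x y : (- x) ** y = - (x ** y).
Proof. by apply: (addrI (x ** y)); rewrite -rngmulDl !subrr rngmul0l. Qed.

Lemma rngmulNr x y : x ** (- y) = - (x ** y).
Proof. by apply: (addrI (x ** y)); rewrite -rngmulDr !subrr rngmul0r. Qed.

Lemma rngmulBl x y z : (x - y) ** z = x ** z - y ** z.
Proof. by rewrite rngmulDl rngmulNl. Qed.

Lemma rngmulBr x y z : z ** (x - y) = z ** x - z ** y.
Proof. by rewrite rngmulDr rngmulNr. Qed.

End RngTheory.

Section AlmostStabilizer.
Variables (R : rngType) (A : {fset R}) (K : nat).
Hypothesis A_neq0 : A != fset0.
Hypothesis doublingA : (#|` A :+: A| <= K * #|` A|)%N.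
Implicit Types (x y : R) (M : nat).

Definition lmulfs x : {fset R} := [fset x ** a | a in A].

Definition almost_stab M x := (#|` lmulfs x :-: A| <= M * #|` A|)%N.

Lemma mem_lmulfs x a : a \in A -> x ** a \in lmulfs x.
Proof. by move=> aA; apply/imfsetP; exists a. Qed.

Lemma almost_stabW M M' x : (M <= M')%N -> almost_stab M x -> almost_stab M' x.
Proof. by move=> le /leq_trans; apply; rewrite leq_mul2r le orbT. Qed.

Let A_gt0 : (0 < #|` A|)%N. Proof. by rewrite cardfs_gt0. Qed.

(** Ruzsa's covering lemma turns the cardinality bound into a covering of [x A] by [M] translates of
    [A - A], a form that composes under differences and products. *)
Lemma almost_stab_cover M x : almost_stab M x ->
  exists2 T : {fset R}, (#|` T| <= M)%N & forall a, a \in A ->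
    exists t p q, [/\ t \in T, p \in A, q \in A & x ** a = t + (p - q)].
Proof.
move=> xM; have [T leT [_ /fsubsetP coverT]] := ruzsa_covering (lmulfs x) A_neq0.
exists T; first by rewrite -(leq_pmul2r A_gt0) (leq_trans leT).
move=> a /(mem_lmulfs x)/coverT/addfsP[t [_ [tT /subfsP[p [q [pA qA ->]]] ->]]].
by exists t, p, q.
Qed.

Let shuffle (t p q t' p' q' b : R) :
  (t + (p - q)) - (t' + (p' - q')) - b = (t - t') + ((p + q') - (q + p' + b)).
Proof.
rewrite (opprD t') opprB addrACA -[LHS]addrA; congr (_ + _).
by rewrite [X in X - b]addrACA -opprD -[LHS]addrA -opprD.
Qed.

(** [x a - b] regroups as an element of [S] plus one of [2A - 3A], and Plünnecke-Ruzsa bounds the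
    size of the latter set by [K ^ 5 |A|]. *)
Lemma almost_stab_bound M (S : {fset R}) x : (#|` S| <= M)%N ->
  (forall a, a \in A -> exists t t1 p1 q1 t2 p2 q2,
     [/\ t + (t1 - t2) \in S, [/\ p1 \in A & q1 \in A], [/\ p2 \in A & q2 \in A] &
         x ** a = t + ((t1 + (p1 - q1)) - (t2 + (p2 - q2)))]) ->
  almost_stab (M * K ^ 5) x.
Proof.
move=> leS xA.
apply: (@leq_trans #|` S :+: (iter_addfs A 1 :-: iter_addfs A 2)|).
  apply/fsubset_leq_card/fsubsetP => _ /subfsP[_ [b [/imfsetP[a /= aA ->] bA ->]]].
  have [t [t1 [p1 [q1 [t2 [p2 [q2 [tS [p1A q1A] [p2A q2A] ->]]]]]]]] := xA _ aA.
  by rewrite -addrA shuffle addrA mem_addfs ?mem_subfs ?mem_addfs.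
apply: leq_trans (card_addfs _ _) _; rewrite -mulnA leq_mul //.
exact: plunnecke_ruzsa 1 2 A_neq0 doublingA.
Qed.

Lemma almost_stabB M M' x y : almost_stab M x -> almost_stab M' y ->
  almost_stab (M * M' * K ^ 5) (x - y).
Proof.
move=> /almost_stab_cover[T leT xT] /almost_stab_cover[T' leT' yT'].
apply: (@almost_stab_bound _ (T :-: T')).
  by apply: leq_trans (card_subfs _ _) _; exact: leq_mul.
move=> a aA; have [t1 [p1 [q1 [t1T p1A q1A e1]]]] := xT _ aA.
have [t2 [p2 [q2 [t2T p2A q2A e2]]]] := yT' _ aA.
exists 0, t1, p1, q1, t2, p2, q2.
by rewrite !add0r mem_subfs // rngmulBl e1 e2.
Qed.

(** Covering [y A] first, [y a = t + (p - q)] gives [x y a = x t + (x p - x q)]. Covering [x A]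
    twice then leaves the offsets in [x T' + (T - T)]. *)
Lemma almost_stabM M M' x y : almost_stab M x -> almost_stab M' y ->
  almost_stab (M' * (M * M) * K ^ 5) (x ** y).
Proof.
move=> /almost_stab_cover[T leT xT] /almost_stab_cover[T' leT' yT'].
pose xT' := [fset x ** t | t in T'].
apply: (@almost_stab_bound _ (xT' :+: (T :-: T))).
  apply: leq_trans (card_addfs _ _) _; rewrite leq_mul //.
    by apply: leq_trans leT'; exact: leq_imfset_card.
  by apply: leq_trans (card_subfs _ _) _; exact: leq_mul.
move=> a aA; have [t [p [q [tT' pA qA e]]]] := yT' _ aA.
have [t1 [p1 [q1 [t1T p1A q1A e1]]]] := xT _ pA.
have [t2 [p2 [q2 [t2T p2A q2A e2]]]] := xT _ qA.
exists (x ** t), t1, p1, q1, t2, p2, q2; split=> //.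
  by rewrite mem_addfs ?mem_subfs //; apply/imfsetP; exists t.
by rewrite -rngmulA e rngmulDr rngmulBr e1 e2.
Qed.

(** Multiplication by [x] embeds [y A - A] into [A - x A]. *)
Lemma almost_stab_inv M x y : cancel (rngmul x) (rngmul y) ->
  cancel (rngmul y) (rngmul x) -> almost_stab M x -> almost_stab M y.
Proof.
move=> xK yK; apply: leq_trans; rewrite card_subfsC.
apply: (@leq_card_fset_inj _ _ _ _ (rngmul x)) => [z w _ _|]; first exact: can_inj xK _ _.
move=> _ /subfsP[b [_ [bA /imfsetP[a /= aA ->] ->]]].
by rewrite rngmulBr yK mem_subfs // mem_lmulfs.
Qed.
End AlmostStabilizer.

(** Here [m] is the bound for [b^-1 (y - z)] with [y], [z] in the set [A1] of [popular_dilate]; the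
    result is the bound for one such element times the inverse of another. *)
Definition quotient_const K := let m := (2 * K ^ 3 * (2 * K ^ 3) * K ^ 5)%N in
  (m * (m * m) * K ^ 5)%N.

Definition closure_const K :=
  (quotient_const K * (quotient_const K * quotient_const K) * K ^ 5)%N.

(** * The finite subring normalised by a unit *)

Section InvariantSubring.
Variables (R : rngType) (A : {fset R}) (K : nat).
Variables (e : R) (u : pred R) (inv : R -> R).
Hypothesis K_gt0 : (0 < K)%N.
Hypothesis A_neq0 : A != fset0.
Hypothesis doublingA : (#|` A :+: A| <= K * #|` A|)%N.
Hypothesis productA : (#|` prodset A A| <= K * #|` A|)%N.
Hypothesis mul1e : forall x, e ** x = x.
Hypothesis mule1 : forall x, x ** e = x.
Hypothesis mulVu : forall x, u x -> inv x ** x = e.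
Hypothesis muluV : forall x, u x -> x ** inv x = e.

Local Notation n := #|` A|.

Let bad := [fset p in A `*` A | ~~ u (p.1 - p.2)].
Let Au := [fset a in A | u a].

Hypothesis many_units : (n <= 2 * #|` Au|)%N.

Let n_gt0 : (0 < n)%N. Proof. by rewrite cardfs_gt0. Qed.

Let muluK x : u x -> cancel (rngmul x) (rngmul (inv x)).
Proof. by move=> ux y; rewrite rngmulA mulVu // mul1e. Qed.

Let muluVK x : u x -> cancel (rngmul (inv x)) (rngmul x).
Proof. by move=> ux y; rewrite rngmulA muluV // mul1e. Qed.

Lemma popular_dilate : exists2 b, b \in Au & exists2 A1 : {fset R},
  A1 `<=` A /\ (n <= 4 * K * #|` A1|)%N &
  forall a, a \in A1 -> almost_stab A (2 * K ^ 3) (inv b ** a).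
Proof.
pose U a b := [fset y in A | b ** y \in lmulfs A a].
have [b bAu le_b] : exists2 b, b \in Au &
    (#|` Au| * n <= K * \sum_(a <- Au) #|` U a b|)%N.
  apply: exists_ge_average.
    by rewrite -cardfs_gt0; move: many_units n_gt0; lia.
  rewrite -big_distrr /= -(leq_pmul2l n_gt0).
  have := @collisions _ _ (Au `*` A) (prodset A A) (fun p => p.1 ** p.2).
  rewrite card_fsetX => /(_ _)/leq_trans le_coll.
  rewrite [leqLHS](_ : _ = (#|` Au| * n) ^ 2)%N; last by ring.
  apply: le_coll => [[a y]|].
    rewrite !inE /= => /andP[/andP[aA _] yA].
    by apply/imfset2P; exists a => //; exists y.
  rewrite mulnA [(n * K)%N]mulnC; apply: leq_mul => //.
  rewrite sum_fsetX; apply: leq_sum => b _.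
  under [leqRHS]eq_bigr => a _ do rewrite card_fset_sep.
  rewrite exchange_big /=; apply: leq_sum => y _; rewrite -card_fset_sep.
  apply: (@leq_card_fset_inj _ _ _ _ fst) => [[a z] [a' z']|[a z]].
    rewrite !inE /= => /andP[/andP[/andP[_ ua] _] /eqP ez].
    move=> /andP[_ /eqP ez'] eqa; move: ez'; rewrite -eqa -ez.
    by move=> /(can_inj (muluK ua))->.
  rewrite !inE /= => /andP[/andP[-> zA] /eqP <-] /=.
  exact: mem_lmulfs.
have ub : u b by move: bAu; rewrite !inE => /andP[].
(* The average of [|U a b|] over [a] is at least [n / K]; the set keeps the [a] that reach half of
   that. *)
exists b => //; exists [fset a in Au | (n <= 2 * K * #|` U a b|)%N].
  split.
    by apply/fsubsetP => a; rewrite !inE => /andP[/andP[]].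
  set A1 := [fset a in Au | _].
  have : (2 * K * (\sum_(a <- Au) #|` U a b|) <= #|` A1| * (2 * K * n) + #|` Au| * n)%N.
    rewrite card_fset_sep big_distrl -sum_fset_const -big_split big_distrr /=.
    apply: leq_sum => a _; have [_|/ltnW//] := leqP n.
    rewrite [(true * _)%N]mul1n -[leqLHS]addn0 leq_add // leq_mul //.
    by apply/fsubset_leq_card/fsubsetP => y; rewrite !inE => /andP[].
  move: le_b many_units; set s := (\sum_(a <- _) _)%N => le_b many_u le_s.
  suff : (#|` Au| <= 2 * K * #|` A1|)%N by lia.
  by rewrite -(leq_pmul2r n_gt0); lia.
move=> a; rewrite !inE => /andP[/andP[aA ua] leU].
have UX : U a b `<=` lmulfs A (inv b ** a).
  apply/fsubsetP => y; rewrite !inE => /andP[yA /imfsetP[z /= zA eq_z]].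
  by rewrite -(muluK ub y) eq_z rngmulA mem_lmulfs.
have le1 : (#|` U a b :+: lmulfs A (inv b ** a)| <= K * n)%N.
  apply: leq_trans doublingA.
  apply: (@leq_card_fset_surj _ _ _ _ (rngmul (inv b ** a))) => z.
  move=> /addfsP[_ [_ [/(fsubsetP UX)/imfsetP[y /= yA ->] /imfsetP[w /= wA ->] ->]]].
  by exists (y + w); rewrite ?rngmulDr ?mem_addfs.
have le2 : (#|` U a b :+: A| <= K * n)%N.
  apply: leq_trans doublingA; apply/fsubset_leq_card/addfsS => //.
  by apply/fsubsetP => y; rewrite !inE => /andP[].
have := ruzsa_triangle_add (U a b) (lmulfs A (inv b ** a)) A.
move=> /leq_trans/(_ (leq_mul le1 le2)).
rewrite /almost_stab; set X := #|` _ :-: _|; move: leU; set c := #|` U a b| => leU leX.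
rewrite -(leq_pmul2l n_gt0); apply: (@leq_trans (2 * K * c * X)); first exact: leq_mul.
apply: (@leq_trans (2 * K * (K * n * (K * n)))); last by apply: eq_leq; ring.
by rewrite -mulnA leq_mul2l leX orbT.
Qed.

(** Without such a quotient, pairs with equal [x p - q] have first coordinates that differ by a
    non-unit, which leaves at most [|A1| |bad|] collisions. As [x p - q] takes at most [M n] values,
    Cauchy-Schwarz gives [|A1|^4 <= M n |A1| |bad|], too much for so few bad pairs. *)
Lemma almost_stab_quotient M (A1 : {fset R}) (x : R) :
  A1 `<=` A -> (n <= 4 * K * #|` A1|)%N ->
  (256 * K ^ 4 * M * #|` bad| < n ^ 2)%N ->
  almost_stab A M x ->
  exists a b c d, [/\ [/\ a \in A1, b \in A1, c \in A1 & d \in A1],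
    u (b - d) & x ** (b - d) = a - c].
Proof.
move=> /fsubsetP A1A leA1 few_bad xM; apply: contrapT => no_quotient.
have bad_coll (p q : R * R) : p \in A1 `*` A1 -> q \in A1 `*` A1 ->
    x ** p.1 - p.2 = x ** q.1 - q.2 -> ~~ u (p.1 - q.1).
  rewrite !inE => /andP[p1 p2] /andP[q1 q2] e_pq; apply/negP => u_pq.
  apply: no_quotient; exists p.2, p.1, q.2, q.1; split => //.
  have -> : x ** (p.1 - q.1) = x ** p.1 - x ** q.1 by rewrite rngmulBr.
  have -> : x ** p.1 = x ** q.1 + (p.2 - q.2) by rewrite addrCA -e_pq subrKC.
  by rewrite addrAC subrr add0r.
have := @collisions _ _ (A1 `*` A1) (lmulfs A x :-: A) (fun p => x ** p.1 - p.2).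
rewrite card_fsetX => /(_ _)/leq_trans le_coll.
have {le_coll} : ((#|` A1| * #|` A1|) ^ 2 <= (M * n) *
    (#|` A1| * #|` bad|))%N.
  apply: le_coll => [p|].
    by rewrite inE => /andP[/A1A p1 /A1A p2]; rewrite mem_subfs ?mem_lmulfs.
  rewrite leq_mul // card_fset_sep !sum_fsetX exchange_big /= -sum_fset_const.
  apply: leq_sum_fset => a aA1.
  apply: (@leq_trans (\sum_(b <- A1) \sum_(d <- A) ~~ u (b - d)%R)%N); last first.
    by apply/leq_sum_fsetS/fsubsetP.
  apply: leq_sum_fset => b bA1; rewrite -card_fset_sep.
  apply: (@leq_card_fset_inj _ _ _ _ fst) => [[d c] [d' c']|[d c]].
    rewrite !inE /= => /andP[_ /eqP ec] /andP[_ /eqP ec'] eqd.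
    by congr pair => //; apply/oppr_inj/(addrI (x ** d)); rewrite ec eqd ec'.
  rewrite 3!inE /= => /andP[/andP[dA1 cA1] /eqP ec].
  rewrite !inE /= A1A //=.
  by apply: (bad_coll (b, a) (d, c)); rewrite ?inE /= ?bA1 ?aA1 ?dA1.
have leA : (#|` A1| <= n)%N by apply/fsubset_leq_card/fsubsetP.
move: few_bad leA1 leA n_gt0; set l := #|` A1|; set m := n; set beta := #|` bad|.
move=> few_bad leA1 leA m_gt0 le_l.
(* The constant [256 K^4] is the fourth power of the [4 K] in [n <= 4 K |A1|]. *)
have le1 : (m ^ 4 <= 256 * K ^ 4 * (l * l) ^ 2)%N.
  rewrite (_ : 256 * K ^ 4 * (l * l) ^ 2 = (4 * K * l) ^ 4)%N; last by ring.
  by rewrite leq_exp2r.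
have le2 : (256 * K ^ 4 * (l * l) ^ 2 <= 256 * K ^ 4 * M * beta * m ^ 2)%N.
  apply: (@leq_trans (256 * K ^ 4 * (M * m * (l * beta)))).
    by rewrite leq_mul2l le_l orbT.
  rewrite (_ : _ * (_ * _) = 256 * K ^ 4 * M * beta * m * l)%N; last by ring.
  by rewrite -mulnn mulnA leq_mul2l leA orbT.
have := leq_trans le1 le2; rewrite (_ : m ^ 4 = m ^ 2 * m ^ 2)%N; last by ring.
by rewrite leq_pmul2r ?expn_gt0 ?m_gt0 // leqNgt few_bad.
Qed.

Let quotient_const_gt0 : (0 < quotient_const K)%N.
Proof. by rewrite /quotient_const !(muln_gt0, expn_gt0) K_gt0. Qed.

Let quotient_closure_le : (quotient_const K * quotient_const K * K ^ 5 <= closure_const K)%N.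
Proof.
rewrite /closure_const leq_mul2r; apply/orP; right.
by rewrite leq_mul2l leq_pmull ?orbT.
Qed.

(* The set [S] of the [x] with [|x A - A| <= quotient_const K * |A|] is a ring
   because it coincides with the analogous set [S'] for [closure_const K], into
   which differences and products of elements of [S] fall: every [x] in [S'] is a
   quotient of differences in [A1], so [x |-> b^-1 x b] maps [S'] to [S]. *)
Lemma invariant_subring :
  (256 * K ^ 4 * closure_const K * #|` bad| < n ^ 2)%N ->
  exists b (A1 S : {fset R}), [/\ u b, A1 `<=` A, (n <= 4 * K * #|` A1|)%N,
    {in S &, forall x y, x - y \in S /\ x ** y \in S} &
    {in S, forall x, inv b ** x ** b \in S /\ b ** x ** inv b \in S} /\
    {in A1, forall a, a ** inv b \in S}].
Proof.
move=> few_bad; have [b bAu [A1 [A1A leA1] A1stab]] := popular_dilate.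
have ub : u b by move: bAu; rewrite !inE => /andP[].
(* Intersecting with the finite set [Q] of quotients makes [S M] finite even if [R] is infinite; by
   [quotS] nothing is lost for bounds up to [closure_const K]. *)
pose Q := [fset (p.1.1 - p.1.2) ** inv (p.2.1 - p.2.2)
            | p in (A1 `*` A1) `*` (A1 `*` A1)].
pose S M := [fset x in Q | `[< almost_stab A M x >]].
have quotS x : almost_stab A (closure_const K) x -> x \in Q /\
    almost_stab A (quotient_const K) (inv b ** x ** b).
  move=> xM; have [a [c [a' [c' [[aA cA a'A c'A] ucc e_x]]]]] :=
    almost_stab_quotient A1A leA1 few_bad xM.
  have {}e_x : x = (a - a') ** inv (c - c').
    by rewrite -e_x -rngmulA muluV // mule1.
  split.
    apply/imfsetP; exists ((a, a'), (c, c')) => //=.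
    by rewrite !inE /= aA a'A cA c'A.
  have diff_stab y z : y \in A1 -> z \in A1 ->
      almost_stab A (2 * K ^ 3 * (2 * K ^ 3) * K ^ 5) (inv b ** (y - z)).
    by move=> yA1 zA1; rewrite rngmulBr; apply: almost_stabB => //; exact: A1stab.
  have -> : inv b ** x ** b = (inv b ** (a - a')) ** (inv (c - c') ** b).
    by rewrite e_x !rngmulA.
  apply: almost_stabM => //; first exact: diff_stab.
  apply: (almost_stab_inv _ _ (diff_stab c c' cA c'A)) => z.
    by rewrite -!rngmulA (rngmulA b) muluV // mul1e muluK.
  by rewrite -!rngmulA (rngmulA (c - c')) muluV // mul1e muluK.
have le34 : (quotient_const K <= closure_const K)%N.
  rewrite /closure_const -mulnA; apply: leq_pmulr.
  by rewrite 2!muln_gt0 quotient_const_gt0 expn_gt0 K_gt0.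
have SE M x : x \in S M <-> x \in Q /\ almost_stab A M x.
  by rewrite !inE; split=> [/andP[? /asboolP]|[-> /asboolP->]].
pose conj x := inv b ** x ** b.
have conj_inj : injective conj.
  apply: (@can_inj _ _ _ (fun x => b ** x ** inv b)) => x.
  by rewrite /conj -!rngmulA muluV // mule1 muluVK.
have SS : S (closure_const K) = S (quotient_const K).
  apply/eqP; rewrite eq_sym eqEfcard; apply/andP; split.
    apply/fsubsetP => x /SE[xQ xM]; apply/SE; split => //.
    exact: almost_stabW le34 xM.
  apply: (@leq_card_fset_inj _ _ _ _ conj) => [x y _ _|x]; first exact: conj_inj.
  move=> /SE[xQ /quotS[_ cxM]]; apply/SE; split=> //.
  by apply: (quotS _ _).1; exact: almost_stabW le34 cxM.
have memS x : almost_stab A (closure_const K) x -> x \in S (quotient_const K).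
  by move=> xM; rewrite -SS; apply/SE; split=> //; exact: (quotS _ xM).1.
have conjS x : x \in S (quotient_const K) -> conj x \in S (quotient_const K).
  by rewrite -{1}SS => /SE[_ /quotS[_ cxM]]; apply: memS; exact: almost_stabW le34 cxM.
have conjVS x : x \in S (quotient_const K) ->
    b ** x ** inv b \in S (quotient_const K).
  (* An injective self-map of a finite set is onto, which gives stability under the inverse
     conjugation. *)
  have conj_im : [fset conj x | x in S (quotient_const K)] = S (quotient_const K).
    apply/eqP; rewrite eqEfcard; apply/andP; split.
      by apply/fsubsetP => _ /imfsetP[y /= yS ->]; exact: conjS.
    by rewrite [leqRHS](card_imfset imfset_key _ conj_inj).
  rewrite -{1}conj_im => /imfsetP[y /= yS ->].
  by rewrite /conj -!rngmulA muluV // mule1 muluVK.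
exists b, A1, (S (quotient_const K)); split=> //.
  move=> x y /SE[_ xM] /SE[_ yM]; split; apply: memS.
    apply: almost_stabW (almost_stabB A_neq0 doublingA xM yM).
    exact: quotient_closure_le.
  exact: almost_stabM.
split=> [x xS|a aA1]; first by split; [exact: conjS|exact: conjVS].
have /conjVS : inv b ** a \in S (quotient_const K).
  apply: memS; apply: almost_stabW (A1stab _ aA1).
  apply: leq_trans le34.
  rewrite /quotient_const /=; apply: (@leq_trans (2 * K ^ 3 * (2 * K ^ 3) * K ^ 5)).
    by rewrite -mulnA leq_pmulr // !(muln_gt0, expn_gt0) K_gt0.
  by rewrite -[leqRHS]mulnA leq_pmulr // !(muln_gt0, expn_gt0) K_gt0.
by rewrite muluVK.
Qed.

End InvariantSubring.

(** * The twisted polynomial model *)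

Section FiniteSubrng.
Variables (R : rngType) (S : {fset R}).

(** The closure proofs are arguments of the type, so that the instances below can recover them from
    it. *)
Definition subrng of 0 \in S & {in S &, forall x y, x - y \in S} &
  {in S &, forall x y, x ** y \in S} : Type := S.

Variables (S0 : 0 \in S) (SB : {in S &, forall x y, x - y \in S}).
Variable SM : {in S &, forall x y, x ** y \in S}.

Local Notation T := (subrng S0 SB SM).

HB.instance Definition _ := Finite.copy T S.

Implicit Types x y z : T.

Let SN (x : R) : x \in S -> - x \in S.
Proof. by move=> xS; rewrite -sub0r SB. Qed.

Let SD (x y : R) : x \in S -> y \in S -> x + y \in S.
Proof. by move=> xS yS; rewrite -[y]opprK SB // SN. Qed.

Definition subrng_val x : R := \val (x : S).

Lemma subrng_valP x : subrng_val x \in S.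
Proof. exact: (valP (x : S)). Qed.

Lemma subrng_val_inj : injective subrng_val.
Proof. exact: val_inj. Qed.

Definition subrng_sub (x : R) (xS : x \in S) : T := [` xS].

Definition subrng_add x y := subrng_sub (SD (subrng_valP x) (subrng_valP y)).
Definition subrng_opp x := subrng_sub (SN (subrng_valP x)).
Definition subrng_mul x y := subrng_sub (SM (subrng_valP x) (subrng_valP y)).

Lemma subrng_addA : associative subrng_add.
Proof. by move=> x y z; apply: subrng_val_inj; exact: addrA. Qed.

Lemma subrng_addC : commutative subrng_add.
Proof. by move=> x y; apply: subrng_val_inj; exact: addrC. Qed.

Lemma subrng_add0 : left_id (subrng_sub S0) subrng_add.
Proof. by move=> x; apply: subrng_val_inj; exact: add0r. Qed.

Lemma subrng_addN : left_inverse (subrng_sub S0) subrng_opp subrng_add.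
Proof. by move=> x; apply: subrng_val_inj; exact: addNr. Qed.

HB.instance Definition _ :=
  GRing.isZmodule.Build T subrng_addA subrng_addC subrng_add0 subrng_addN.

Lemma subrng_mulA : associative subrng_mul.
Proof. by move=> x y z; apply: subrng_val_inj; exact: rngmulA. Qed.

Lemma subrng_mulDl : left_distributive subrng_mul +%R.
Proof. by move=> x y z; apply: subrng_val_inj; exact: rngmulDl. Qed.

Lemma subrng_mulDr : right_distributive subrng_mul +%R.
Proof. by move=> x y z; apply: subrng_val_inj; exact: rngmulDr. Qed.

HB.instance Definition _ :=
  Zmodule_isRng.Build T subrng_mulA subrng_mulDl subrng_mulDr.

End FiniteSubrng.

Section TwistedEmbedding.
Variables (R : rngType) (A S : {fset R}) (e b c : R).
Hypothesis mul1e : forall x, e ** x = x.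
Hypothesis mule1 : forall x, x ** e = x.
Hypothesis bc : b ** c = e.
Hypothesis cb : c ** b = e.
Hypothesis S0 : 0 \in S.
Hypothesis SB : {in S &, forall x y, x - y \in S}.
Hypothesis SM : {in S &, forall x y, x ** y \in S}.
Hypothesis Sconj : {in S, forall x, c ** x ** b \in S /\ b ** x ** c \in S}.
Hypothesis ASc : {in A, forall a, a ** c \in S}.

Let R0 : finRngType := subrng S0 SB SM.

Let val (x : R0) : R := subrng_val x.

Let proj (y : R) : R0 := oapp (fun s : S => (s : subrng S0 SB SM)) 0 (insub y).

Let valP x : val x \in S. Proof. exact: subrng_valP. Qed.

Let val_inj : injective val. Proof. exact: subrng_val_inj. Qed.

Let val_proj y : y \in S -> val (proj y) = y.
Proof. by move=> yS; rewrite /val /proj insubT. Qed.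

Let projE y x : y = val x -> proj y = x.
Proof. by move=> ->; apply: val_inj; rewrite val_proj. Qed.

Let conj (x : R0) : R0 := subrng_sub S0 SB SM (Sconj (valP x)).2.
Let conjV (x : R0) : R0 := subrng_sub S0 SB SM (Sconj (valP x)).1.

Let val_conj x : val (conj x) = b ** val x ** c. Proof. by []. Qed.
Let val_conjV x : val (conjV x) = c ** val x ** b. Proof. by []. Qed.
Let valD x y : val (x + y) = val x + val y. Proof. by []. Qed.
Let valM x y : val (x ** y) = val x ** val y. Proof. by []. Qed.

Let conj_bij : bijective conj.
Proof.
exists conjV => x; apply: val_inj.
  by rewrite val_conjV val_conj -!rngmulA cb mule1 rngmulA cb mul1e.
by rewrite val_conj val_conjV -!rngmulA bc mule1 rngmulA bc mul1e.
Qed.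

Let conjD : {morph conj : x y / x + y}.
Proof.
by move=> x y; apply: val_inj; rewrite valD !val_conj valD rngmulDr rngmulDl.
Qed.

Let conjM : {morph conj : x y / x ** y}.
Proof.
move=> x y; apply: val_inj; rewrite valM !val_conj valM -!rngmulA.
by rewrite (rngmulA c b) cb mul1e.
Qed.

Let phi := RngAut conj_bij conjD conjM.

Let rngexp (x : R) n : R := iter n (rngmul x) e.

Let rngexpD x n m : rngexp x (n + m) = rngexp x n ** rngexp x m.
Proof. by elim: n => [|n IH]; rewrite ?mul1e //= IH rngmulA. Qed.

Let rngexpSr x n : rngexp x n.+1 = rngexp x n ** x.
Proof. by rewrite -addn1 rngexpD /= mule1. Qed.

Let rngexp_cb n : rngexp c n ** rngexp b n = e.
Proof.
elim: n => [|n IH]; first by rewrite mul1e.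
by rewrite rngexpSr /= -rngmulA (rngmulA c) cb mul1e.
Qed.

Let val_iter_phi n x : val (iter n phi x) = rngexp b n ** val x ** rngexp c n.
Proof.
elim: n => [|n IH]; first by rewrite /= mul1e mule1.
by rewrite iterS val_conj IH (rngexpSr c n) /= !rngmulA.
Qed.

(** With [c] inverse to [b], [A] lies in [S b]. In a product the powers of [b] move to the right
    past [S]: the last factor [a c] gets conjugated by [b^(n+1)] and stays in [S], being a value of
    [iter n.+1 phi]. *)
Let powset_exp n x : x \in powset A n.+1 -> x ** rngexp c n.+1 \in S.
Proof.
elim: n x => [|n IH] x; first by move=> /ASc; rewrite /= mule1.
case/imfset2P => y /= /IH yS [a /= /ASc aS ->].
have -> : y ** a ** rngexp c n.+2 = (y ** rngexp c n.+1) **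
    (rngexp b n.+1 ** (a ** c) ** rngexp c n.+1).
  rewrite -(rngmulA y (rngexp c n.+1)) -(rngmulA (rngexp b n.+1)).
  rewrite (rngmulA (rngexp c n.+1)) rngexp_cb mul1e -(rngmulA a) -(rngmulA y).
  by rewrite [rngexp c n.+2]/=.
by apply: SM => //; rewrite -(val_proj aS) -val_iter_phi.
Qed.

Let span_exp n x : (1 <= n)%N -> span_pow A n x -> x ** rngexp c n \in S.
Proof.
move=> n_gt0; move: x; apply: (@smallest_sub _ _ _ [set x | x ** rngexp c n \in S]).
  split=> [|y z yS zS] /=; first by rewrite rngmul0l.
  by rewrite rngmulBl SB.
by case: n n_gt0 => // n _ y; exact: powset_exp.
Qed.

(** The variable [t] plays the role of [b]: [iota n] sends [x] to [(x c^n) t^n], and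
    [x y c^(n+m) = (x c^n) phi^n (y c^m)] because [phi] is conjugation by [b]. *)
Lemma twisted_embedding : exists (R0 : finRngType) (phi : rngAut R0)
  (iota : nat -> R -> twpoly phi), graded_embedding A iota.
Proof.
exists R0, phi, (fun n x => twmonom phi n (proj (x ** rngexp c n))); split.
- by move=> n x _ _; exists (proj (x ** rngexp c n)).
- move=> n x y n_gt0 /(span_exp n_gt0) xS /(span_exp n_gt0) yS.
  move=> /(congr1 (monalg.mcoeff n)); rewrite !monalg.mcoeffUU => /(congr1 val).
  rewrite !val_proj // => /(congr1 (rngmul^~ (rngexp b n))).
  by rewrite -!rngmulA rngexp_cb !mule1.
- move=> n x y n_gt0 /(span_exp n_gt0) xS /(span_exp n_gt0) yS.
  rewrite -twmonomD; congr twmonom.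
  by apply: projE; rewrite valD !val_proj // rngmulDl.
- move=> n m x y n_gt0 m_gt0 /(span_exp n_gt0) xS /(span_exp m_gt0) yS.
  apply/esym; apply: etrans (twmulUU _ _ _ _ _) _; congr twmonom.
  apply/esym/projE; rewrite valM val_iter_phi !val_proj //.
  rewrite addnC rngexpD -!rngmulA (rngmulA (rngexp c n)) rngexp_cb.
  by rewrite mul1e.
Qed.

End TwistedEmbedding.

(** * Polynomial functions and dense sets of zeros *)

Section PolynomialFunctions.
Variables (F : fieldType) (V : vectType F).
Implicit Types (P Q l : V -> F) (h x y : V) (hs : seq V).

Definition functional l := forall a x y, l (a *: x + y) = a * l x + l y.

(* [poly_lt D P]: the function [P] is a polynomial of degree < [D]. *)
Inductive poly_lt : nat -> (V -> F) -> Prop :=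
| Poly_lt0 D : poly_lt D (fun=> 0)
| Poly_ltC D c : poly_lt D.+1 (fun=> c)
| Poly_ltM D l P : functional l -> poly_lt D P -> poly_lt D.+1 (fun x => l x * P x)
| Poly_ltD D P Q : poly_lt D P -> poly_lt D Q -> poly_lt D (fun x => P x + Q x)
| Poly_ltS D P : poly_lt D P -> poly_lt D.+1 P.

Definition diff h P : V -> F := fun x => P (x + h) - P x.

Definition diffs hs P : V -> F := foldr diff P hs.

Lemma functionalD l x y : functional l -> l (x + y) = l x + l y.
Proof. by move=> lin; rewrite -[x in LHS]scale1r lin mul1r. Qed.

Lemma functional0 l : functional l -> l 0 = 0.
Proof. by move=> lin; apply: (addrI (l 0)); rewrite -functionalD // !addr0. Qed.

Lemma poly_lt_ext D P Q : P =1 Q -> poly_lt D P -> poly_lt D Q.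
Proof. by move=> /funext->. Qed.

Lemma poly_ltW D D' P : (D <= D')%N -> poly_lt D P -> poly_lt D' P.
Proof.
move=> /subnKC <-; elim: (D' - D)%N => [|k IH]; first by rewrite addn0.
by move=> /IH; rewrite addnS; exact: Poly_ltS.
Qed.

Lemma poly_lt0 P x : poly_lt 0 P -> P x = 0.
Proof.
move eD: 0%N => D PD; elim: PD eD => // {}D {}P Q _ IHP _ IHQ eD.
by rewrite IHP // IHQ // addr0.
Qed.

Lemma poly_ltZ D c P : poly_lt D P -> poly_lt D (fun x => c * P x).
Proof.
elim=> {D P} [D|D c'|D l P lin _ IH|D P Q _ IHP _ IHQ|D P _ IH].
- by apply: poly_lt_ext (Poly_lt0 D) => x; rewrite mulr0.
- exact: Poly_ltC.
- by apply: poly_lt_ext (Poly_ltM lin IH) => x; rewrite mulrCA.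
- by apply: poly_lt_ext (Poly_ltD IHP IHQ) => x; rewrite mulrDr.
- exact: Poly_ltS.
Qed.

Lemma poly_ltB D P Q : poly_lt D P -> poly_lt D Q -> poly_lt D (fun x => P x - Q x).
Proof.
move=> PD /(poly_ltZ (-1)) QD; apply: poly_lt_ext (Poly_ltD PD QD) => x.
by rewrite mulN1r.
Qed.

Lemma diffM l P h x : functional l ->
  diff h (fun y => l y * P y) x = l x * diff h P x + l h * P x + l h * diff h P x.
Proof. by move=> lin; rewrite /diff functionalD //; ring. Qed.

Lemma diff_lt D P h : poly_lt D P -> poly_lt D.-1 (diff h P).
Proof.
elim=> {D P} [D|D c|D l P lin PD IH|D P Q _ IHP _ IHQ|D P _ IH].
- by apply: poly_lt_ext (Poly_lt0 _) => x; rewrite /diff subr0.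
- by apply: poly_lt_ext (Poly_lt0 _) => x; rewrite /diff subrr.
- rewrite /=; case: D => [|D] in PD IH *.
    apply: poly_lt_ext (Poly_lt0 _) => x.
    by rewrite diffM // /diff !(poly_lt0 _ PD) subrr !mulr0 !addr0.
  rewrite /= in IH.
  apply: poly_lt_ext (Poly_ltD (Poly_ltD (Poly_ltM lin IH) (poly_ltZ (l h) PD))
    (poly_ltZ (l h) (Poly_ltS IH))) => x.
  by rewrite diffM.
- by apply: poly_lt_ext (Poly_ltD IHP IHQ) => x; rewrite /diff; ring.
- by rewrite /=; apply: poly_ltW IH; exact: leq_pred.
Qed.

Definition diff_defect a h h' P : V -> F :=
  fun x => diff (a *: h + h') P x - a * diff h P x - diff h' P x.

(* To first order, [h |-> diff h P] is linear. *)
Lemma diff_defect_lt D P a h h' :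
  poly_lt D P -> poly_lt (D - 2) (diff_defect a h h' P).
Proof.
elim=> {D P} [D|D c|D l P lin PD IH|D P Q _ IHP _ IHQ|D P _ IH].
- by apply: poly_lt_ext (Poly_lt0 _) => x; rewrite /diff_defect /diff; ring.
- by apply: poly_lt_ext (Poly_lt0 _) => x; rewrite /diff_defect /diff; ring.
- have defectM x : diff_defect a h h' (fun y => l y * P y) x =
      l x * diff_defect a h h' P x + l (a *: h + h') * diff (a *: h + h') P x
      - a * l h * diff h P x - l h' * diff h' P x.
    by rewrite /diff_defect !diffM // lin; ring.
  case: D => [|[|D]] in PD IH *.
  + apply: poly_lt_ext (Poly_lt0 _) => x; rewrite defectM /diff_defect /diff.
    by rewrite !(poly_lt0 _ PD); ring.
  + have P0 k := diff_lt k PD; apply: poly_lt_ext (Poly_lt0 _) => x.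
    by rewrite defectM /diff_defect !(poly_lt0 _ (P0 _)); ring.
  rewrite !subSS !subn0 in IH *.
  have PS k := poly_ltZ (l k) (diff_lt k PD).
  apply: poly_lt_ext (poly_ltB (poly_ltB (Poly_ltD (Poly_ltM lin IH) (PS (a *: h + h')))
    (poly_ltZ a (PS h))) (PS h')) => x.
  by rewrite defectM; ring.
- by apply: poly_lt_ext (Poly_ltD IHP IHQ) => x; rewrite /diff_defect /diff; ring.
- by apply: poly_ltW IH; rewrite leq_sub2r.
Qed.

Lemma diffs_lt D P hs : poly_lt D P -> poly_lt (D - size hs) (diffs hs P).
Proof.
by move=> PD; elim: hs => [|h hs IH]; rewrite ?subn0 //= subnS; exact: diff_lt.
Qed.

Lemma diffC h h' P : diff h (diff h' P) = diff h' (diff h P).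
Proof. by apply/funext => x; rewrite /diff (addrAC x); ring. Qed.

Lemma diffs_diff hs h P : diffs hs (diff h P) = diff h (diffs hs P).
Proof. by elim: hs => //= h' hs ->; rewrite diffC. Qed.

Lemma diffsD hs P Q x : diffs hs (fun y => P y + Q y) x = diffs hs P x + diffs hs Q x.
Proof. by elim: hs x => //= h hs IH x; rewrite /diff !IH; ring. Qed.

Lemma diffsZ hs c P x : diffs hs (fun y => c * P y) x = c * diffs hs P x.
Proof. by elim: hs x => //= h hs IH x; rewrite /diff !IH; ring. Qed.

(** The defect of linearity has degree less than [D], so [D] further differences annihilate it. *)
Lemma diffs_linear D P hs x : poly_lt D.+2 P -> size hs = D ->
  functional (fun h => diffs hs (diff h P) x).
Proof.
move=> PD size_hs a h h'; have := diffs_lt hs (diff_defect_lt a h h' PD).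
rewrite size_hs -addn2 addnK subnn => /(poly_lt0 x).
rewrite (_ : diff_defect a h h' P = fun y => (diff (a *: h + h') P y
  + (- a) * diff h P y) + (-1) * diff h' P y); last first.
  by apply/funext => y; rewrite /diff_defect; ring.
by rewrite !(diffsD, diffsZ) => defect0; rewrite -[RHS]addr0 -defect0; ring.
Qed.

(** The Leibniz rule for repeated differences in one direction. At [n = 0] the coefficient [n%:R]
    cancels the term with the truncated [n.-1]. *)
Lemma diffs_nseqM n l P v x : functional l ->
  diffs (nseq n v) (fun y => l y * P y) x =
  l x * diffs (nseq n v) P x + n%:R * l v * diffs (nseq n.-1 v) P (x + v).
Proof.
move=> lin; elim: n x => [|n IH] x; first by rewrite /= mul0r mul0r addr0.
rewrite /= [LHS]/diff !IH functionalD //.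
case: n IH => [|n] IH /=; rewrite /diff; first by ring.
by rewrite -[n.+2]addn1 natrD; ring.
Qed.

Section Products.
Variables (I : Type) (l : I -> V -> F).
Hypothesis l_lin : forall i, functional (l i).

Lemma poly_lt_prod (s : seq I) : poly_lt (size s).+1 (fun x => \prod_(i <- s) l i x).
Proof.
elim: s => [|i s IH].
  by apply: poly_lt_ext (Poly_ltC 0 1) => x; rewrite big_nil.
by apply: poly_lt_ext (Poly_ltM (l_lin i) IH) => x; rewrite big_cons.
Qed.

(** In the Leibniz rule the first term takes more differences of the remaining product than its
    degree, so it vanishes; the second contributes one factor of the factorial at each step. *)
Lemma diffs_prod (s : seq I) v x :
  diffs (nseq (size s) v) (fun x => \prod_(i <- s) l i x) x =
  (size s)`!%:R * \prod_(i <- s) l i v.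
Proof.
elim: s x => [|i s IH] x; first by rewrite /= !big_nil mulr1.
rewrite (_ : (fun x => _) = fun x => l i x * \prod_(i <- s) l i x); last first.
  by apply/funext => y; rewrite big_cons.
rewrite diffs_nseqM // [size (i :: s)]/= [_.+1.-1]/= IH.
have := diffs_lt (nseq (size s).+1 v) (poly_lt_prod s).
rewrite size_nseq subnn => /(poly_lt0 x) ->.
by rewrite big_cons factS natrM; ring.
Qed.

End Products.

Lemma poly_lt_det m (M : V -> 'M[F]_m) :
  (forall i j, functional (fun x => M x i j)) ->
  poly_lt m.+1 (fun x => \det (M x)) /\
  forall v x, diffs (nseq m v) (fun x => \det (M x)) x = m`!%:R * \det (M v).
Proof.
move=> M_lin; have size_ord : size (index_enum 'I_m) = m.
  by rewrite -sum1_size big_const_ord iter_addn_0 mul1n.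
have prod_lin (s : {perm 'I_m}) i : functional (fun x => M x i (s i)) by exact: M_lin.
split=> [|v x]; rewrite /determinant; elim: index_enum => [|s r IH].
- by apply: poly_lt_ext (Poly_lt0 _) => x; rewrite big_nil.
- have /(poly_ltZ ((-1) ^+ s)) := poly_lt_prod (prod_lin s) (index_enum 'I_m).
  rewrite size_ord => prod_lt.
  by apply: poly_lt_ext (Poly_ltD prod_lt IH) => x; rewrite big_cons.
- under eq_fun do rewrite big_nil.
  by rewrite big_nil mulr0; elim: (nseq m v) x => //= h hs IH x; rewrite /diff !IH subrr.
- under eq_fun do rewrite big_cons.
  rewrite diffsD diffsZ IH big_cons mulrDr; congr (_ + _).
  have := diffs_prod (prod_lin s) (index_enum 'I_m) v x.
  by rewrite size_ord => ->; rewrite mulrCA.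
Qed.

End PolynomialFunctions.

(** * Popular differences and dense sets of zeros *)

Definition shift_meet (V : zmodType) (B : {fset V}) (h : V) : {fset V} :=
  [fset b in B | b + h \in B].

(** [L] is meant to bound [|B - B| / |B|]. A difference then has on average at least [|B| / L]
    representations, and a popular one reaches half of that. *)
Definition popular_diffs (V : zmodType) (L : nat) (B : {fset V}) : {fset V} :=
  [fset h in B :-: B | (#|` B| <= 2 * L * #|` shift_meet B h|)%N].

(** At most [L |B|] differences are unpopular, each with fewer than [|B| / (2 L)] representations,
    so they account for at most half of the pairs. Averaging over the pairs yields [b]. *)
Lemma popular_diffs_dense (V : zmodType) (L : nat) (B : {fset V}) :
  B != fset0 -> (#|` B :-: B| <= L * #|` B|)%N ->
  exists2 b, b \in B &
    (#|` B| <= 2 * #|` [fset c in B | (c - b)%R \in popular_diffs L B]|)%N.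
Proof.
move=> B0 leL; have B_gt0 : (0 < #|` B|)%N by rewrite cardfs_gt0.
set H := popular_diffs L B.
have L_gt0 : (0 < L)%N.
  move: leL; rewrite lt0n; apply: contraTneq => ->; rewrite mul0n -ltnNge.
  have [b bB] := fset0Pn _ B0; rewrite cardfs_gt0; apply/fset0Pn; exists (b - b).
  exact: mem_subfs.
apply: exists_ge_average => //; rewrite -big_distrr /=.
pose unpop b := #|` [fset c in B | c - b \notin H]|.
have split_count : (\sum_(b <- B) #|` [fset c in B | (c - b)%R \in H]| +
    \sum_(b <- B) unpop b = #|` B| * #|` B|)%N.
  rewrite -big_split -sum_fset_const /=; apply: eq_bigr => b _.
  rewrite /unpop !card_fset_sep -big_split /= card_fset_sum1.
  by apply: eq_bigr => c _; case: (_ \in H).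
suff : (2 * \sum_(b <- B) unpop b <= #|` B| * #|` B|)%N.
  move: split_count; set s1 := (\sum_(b <- B) #|` _|)%N.
  by set s2 := (\sum_(b <- B) unpop b)%N => <-; lia.
have -> : (\sum_(b <- B) unpop b =
    \sum_(h <- B :-: B) (h \notin H) * #|` shift_meet B h|)%N.
  have count_diff b c : b \in B -> c \in B ->
      ((c - b)%R \notin H = \sum_(h <- B :-: B) (h \notin H) * ((b + h)%R == c) :> nat)%N.
    move=> bB cB; rewrite (big_fsetD1 (c - b)) ?mem_subfs //= subrKC eqxx muln1.
    rewrite big_seq big1 ?addn0 // => h; rewrite !inE => /andP[neq_h _].
    suff /negPf-> : b + h != c by rewrite muln0.
    by apply: contraNneq neq_h => <-; rewrite addrAC subrr add0r.
  have expand b : b \in B -> unpop b =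
      (\sum_(h <- B :-: B) (h \notin H) * ((b + h)%R \in B))%N.
    move=> bB; rewrite /unpop card_fset_sep big_seq.
    under eq_bigr => c cB do rewrite (count_diff b c bB cB).
    rewrite -big_seq exchange_big /=; apply: eq_bigr => h _; rewrite -big_distrr /=.
    congr (_ * _)%N; have [bhB|bhB] := boolP (b + h \in B).
      rewrite (big_fsetD1 (b + h)) //= eqxx big_seq big1 // => c.
      by rewrite !inE eq_sym => /andP[/negPf->].
    rewrite big_seq big1 // => c cB.
    by rewrite (_ : _ == _ = false) //; apply: contraNF bhB => /eqP->.
  rewrite big_seq; under eq_bigr => b bB do rewrite (expand b bB).
  rewrite -big_seq exchange_big /=; apply: eq_bigr => h _.
  by rewrite -big_distrr /= card_fset_sep.
rewrite -(leq_pmul2l L_gt0) mulnA [(L * 2)%N]mulnC big_distrr /= mulnA.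
apply: (@leq_trans (#|` B :-: B| * #|` B|)); last by rewrite leq_mul2r leL orbT.
rewrite -sum_fset_const; apply: leq_sum_fset => h hD.
have -> : (h \in H) = (#|` B| <= 2 * L * #|` shift_meet B h|)%N.
  by rewrite !inE hD.
have [_|/ltnW le_h] := leqP #|` B| (2 * L * #|` shift_meet B h|).
  by rewrite [((~~ true) * _)%N]mul0n muln0.
by rewrite [((~~ false) * _)%N]mul1n.
Qed.

Section DenseZeros.
Variables (F : fieldType) (V : vectType F).
Implicit Types (B : {fset V}) (P : V -> F) (U W : {vspace V}).

Lemma functional_span (l : V -> F) (s : seq V) : functional l ->
  {in s, forall x, l x = 0} -> {in <<s>>%VS, forall x, l x = 0}.
Proof.
move=> lin; elim: s => [|a s IH] l0 x.
  by rewrite span_nil memv0 => /eqP->; exact: functional0.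
rewrite span_cons => /memv_addP[_ /vlineP[k ->] [y ys ->]].
rewrite lin l0 ?mem_head // mulr0 add0r IH // => z zs.
by rewrite l0 // inE zs orbT.
Qed.

(** The recursion follows the passage from [B] to [shift_meet B h] for a popular [h]: the size drops
    by a factor at most [2 L], and the bound [L] on [|B - B| / |B|] becomes [2 L ^ 2]. *)
Fixpoint dense_const D L :=
  if D is D'.+1 then (2 * L * dense_const D' (2 * L ^ 2))%N else 2.

Lemma dense_const_ge2 D L : (0 < L)%N -> (2 <= dense_const D L)%N.
Proof.
elim: D L => //= D IH L L_gt0; have := IH (2 * L ^ 2)%N.
by rewrite muln_gt0 expn_gt0 L_gt0 => /(_ isT); nia.
Qed.

Definition inter_affine B x U : {fset V} := [fset b in B | b - x \in U].

(* By induction on the degree, applying [diff h] for the popular differences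
   [h] of [B]. Those span [W], as otherwise a translate of their span would
   contain half of [B]. *)
Lemma dense_zeros D L P B W : poly_lt D.+1 P -> B != fset0 ->
  (#|` B :-: B| <= L * #|` B|)%N ->
  {in B &, forall b c, b - c \in W} ->
  (forall U, (U <= W)%VS -> ~~ (W <= U)%VS -> forall x,
     dense_const D L * #|` inter_affine B x U| < #|` B|)%N ->
  {in B, forall b, P b = 0} ->
  forall hs, size hs = D -> {subset hs <= W} -> forall x, diffs hs P x = 0.
Proof.
elim: D L P B => [|D IH] L P B P_lt B0 leL BW thin PB hs size_hs hsW x.
  have [b bB] := fset0Pn _ B0.
  rewrite (size0nil size_hs) /=; have /(poly_lt0 b) := diff_lt (x - b) P_lt.
  by rewrite /diff subrKC (PB b bB) subr0.
case: hs => // h hs in size_hs hsW *; case: size_hs => size_hs.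
have hW : h \in W by apply: hsW; rewrite mem_head.
have {}hsW : {subset hs <= W} by move=> k khs; apply: hsW; rewrite inE khs orbT.
rewrite /= -diffs_diff.
pose U := <<popular_diffs L B>>%VS.
have diffs_popular k : k \in popular_diffs L B -> diffs hs (diff k P) x = 0.
  rewrite inE => /andP[_ k_pop].
  have B_gt0 : (0 < #|` B|)%N by rewrite cardfs_gt0.
  have subB : shift_meet B k `<=` B by apply/fsubsetP => b; rewrite inE => /andP[].
  apply: (IH (2 * L ^ 2)%N _ (shift_meet B k)) => //.
  - exact: diff_lt P_lt.
  - rewrite -cardfs_gt0 lt0n; apply: contraTneq k_pop => ->.
    by rewrite muln0 -ltnNge.
  - apply: leq_trans (fsubset_leq_card (subfsS subB subB)) _.
    apply: leq_trans leL _.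
    apply: (@leq_trans (L * (2 * L * #|` shift_meet B k|))).
      by rewrite leq_mul2l k_pop orbT.
    by apply: eq_leq; ring.
  - by move=> b c /(fsubsetP subB) bB /(fsubsetP subB) cB; exact: BW.
  - move=> T TW WT y; have := thin _ TW WT y.
    have : (#|` inter_affine (shift_meet B k) y T| <= #|` inter_affine B y T|)%N.
      apply/fsubset_leq_card/fsubsetP => b; rewrite !inE => /andP[/andP[-> _] ->//].
    move=> le_meet lt_B; have := leq_trans lt_B k_pop.
    rewrite -[dense_const D.+1 L]/(2 * L * dense_const D (2 * L ^ 2))%N -mulnA ltn_mul2l.
    by case/andP => _; apply: leq_ltn_trans; rewrite leq_mul2l le_meet orbT.
  - move=> b; rewrite inE => /andP[bB bkB].
    by rewrite /diff !PB // subrr.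
have [WU|nWU] := boolP (W <= U)%VS.
  (* The expression is linear in [h], so its vanishing at popular differences extends to their
     span. *)
  apply: (functional_span (diffs_linear x P_lt size_hs) diffs_popular).
  exact: (subvP WU).
have UW : (U <= W)%VS.
  apply/span_subvP => k; rewrite inE => /andP[/subfsP[b [c [bB cB ->]]] _].
  exact: BW.
have [b bB] := popular_diffs_dense B0 leL.
have : (#|` [fset c in B | (c - b)%R \in popular_diffs L B]| <=
        #|` inter_affine B b U|)%N.
  apply/fsubset_leq_card/fsubsetP => c; rewrite !inE => /andP[-> /= cb].
  by apply: memv_span; rewrite inE.
have := thin _ UW nWU b.
have : (2 <= dense_const D.+1 L)%N.
  apply: dense_const_ge2; move: leL; rewrite lt0n; apply: contraTneq => ->.
  rewrite mul0n -ltnNge cardfs_gt0; apply/fset0Pn; exists (b - b).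
  exact: mem_subfs.
move=> d_ge2 lt_d le_pop /leq_trans/(_ (leq_mul (leqnn 2) le_pop)) le_B.
have := leq_ltn_trans le_B (leq_ltn_trans (leq_mul d_ge2 (leqnn _)) lt_d).
by rewrite ltnn.
Qed.

End DenseZeros.

(** [k] counts the dimensions given up. Each costs a factor [dense_const], taken for the ratio
    [L * density_loss D L k'] that bounds [|B' - B'| / |B'|] for the part [B'] of [B] kept so
    far. *)
Fixpoint density_loss D L k :=
  if k is k'.+1
  then (density_loss D L k' * dense_const D (L * density_loss D L k'))%N else 1%N.

Lemma density_loss_gt0 D L k : (0 < L)%N -> (0 < density_loss D L k)%N.
Proof.
move=> L_gt0; elim: k => //= k IH; rewrite muln_gt0 IH /=.
by apply: leq_trans (dense_const_ge2 _ _); rewrite // muln_gt0 L_gt0.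
Qed.

Lemma density_loss_homo D L : (0 < L)%N ->
  {homo density_loss D L : j k / (j <= k)%N}.
Proof.
move=> L_gt0; apply: homo_leq => [//|? ? ?|k]; first exact: leq_trans.
rewrite leq_pmulr //; apply: leq_trans (dense_const_ge2 _ _) => //.
by rewrite muln_gt0 L_gt0 density_loss_gt0.
Qed.

Lemma concentrated_zeros (F : fieldType) (V : vectType F) m (M : V -> 'M[F]_m)
    (B : {fset V}) L :
  (forall i j, functional (fun x => M x i j)) -> m`!%:R != 0 :> F ->
  B != fset0 -> (#|` B :-: B| <= L * #|` B|)%N ->
  {in B, forall b, \det (M b) = 0} ->
  exists (W : {vspace V}) x, {in W, forall v, \det (M v) = 0} /\
    (#|` B| <= density_loss m L (\dim {:V}) * #|` inter_affine B x W|)%N.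
Proof.
move=> M_lin m_fact B0 leL detB; set g := density_loss m L.
have L_gt0 : (0 < L)%N.
  move: leL; rewrite lt0n; apply: contraTneq => ->; rewrite mul0n -ltnNge.
  have [b bB] := fset0Pn _ B0; rewrite cardfs_gt0; apply/fset0Pn; exists (b - b).
  exact: mem_subfs.
have sub_inter y U : inter_affine B y U `<=` B.
  by apply/fsubsetP => b; rewrite inE => /andP[].
(* The density required of a subspace weakens as its codimension grows. At the least dimension where
   it is attained, every proper subspace of [W] falls short, which is the thinness that
   [dense_zeros] asks for. *)
pose dense j := exists (W : {vspace V}) x,
  \dim W = j /\ (#|` B| <= g (\dim {:V} - j) * #|` inter_affine B x W|)%N.
have ex_dense : exists j, `[< dense j >].
  exists (\dim {:V}); apply/asboolP; exists {:V}%VS, 0; split=> //.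
  rewrite subnn mul1n; apply/fsubset_leq_card/fsubsetP => b bB.
  by rewrite !inE bB memvf.
have [_ /asboolP[W [x [<- dense_W]]] min_dim] := ex_minnP ex_dense.
set k := (\dim {:V} - \dim W)%N in dense_W.
have g_gt0 : (0 < g k)%N by exact: density_loss_gt0.
exists W, x; split; last first.
  by apply: leq_trans dense_W _; rewrite leq_mul2r density_loss_homo ?leq_subr ?orbT.
have [P_lt diffs_det] := poly_lt_det M_lin.
have B1_neq0 : inter_affine B x W != fset0.
  apply: contraTneq dense_W => ->; rewrite cardfs0 muln0 -ltnNge.
  by rewrite cardfs_gt0.
have zero := @dense_zeros _ _ m (L * g k) _ (inter_affine B x W) W P_lt B1_neq0.
move=> v vW; have := diffs_det v 0; rewrite zero ?size_nseq //.
- by move=> /esym/eqP; rewrite mulf_eq0 (negPf m_fact) => /eqP.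
- apply: leq_trans (fsubset_leq_card (subfsS (sub_inter x W) (sub_inter x W))) _.
  by apply: leq_trans leL _; rewrite -mulnA leq_mul2l dense_W orbT.
- move=> b c; rewrite !inE => /andP[_ bW] /andP[_ cW].
  have -> : b - c = (b - x) - (c - x) by rewrite opprB addrA subrK.
  exact: memvB.
- move=> U UW nWU y.
  have ltUW : (\dim U < \dim W)%N.
    rewrite ltn_neqAle dimvS // andbT; apply: contraNN nWU => /eqP eq_dim.
    by have /eqP-> : U == W by rewrite eqEdim UW eq_dim /=.
  have nU : (g k.+1 * #|` inter_affine B y U| < #|` B|)%N.
    rewrite ltnNge; apply/negP => dense_U; move: (ltUW); rewrite ltnNge.
    rewrite min_dim //; apply/asboolP; exists U, y; split=> //.
    apply: leq_trans dense_U _; rewrite leq_mul2r density_loss_homo ?orbT //.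
    have := dimvS (subvf W); rewrite /k; lia.
  have := leq_trans nU dense_W; rewrite [g _.+1]/= -mulnA ltn_mul2l.
  case/andP => _; apply: leq_ltn_trans; rewrite leq_mul2l; apply/orP; right.
  by apply/fsubset_leq_card/fsubsetP => b; rewrite !inE => /andP[/andP[-> _]].
- by move=> b; rewrite inE => /andP[/detB].
- by move=> w /nseqP[->].
Qed.

(** * Zero divisors of a finite-dimensional algebra *)

Section EndomorphismMatrix.
Variables (F : fieldType) (V : vectType F).
Variable f : V -> V.
Hypothesis f_lin : forall a x y, f (a *: x + y) = a *: f x + f y.

Local Notation d := (\dim {:V}).
Local Notation b := (vbasis {:V}).

Definition endo_mx : 'M[F]_d := \matrix_(i, j) coord b j (f b`_i).

Let vec (u : 'rV[F]_d) := \sum_i u 0 i *: b`_i.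

Let vec_surj v : exists u, v = vec u.
Proof.
exists (\row_i coord b i v); rewrite /vec {1}(coord_vbasis (memvf v)).
by apply: eq_bigr => i _; rewrite mxE.
Qed.

Let vec_eq0 u : vec u = 0 -> u = 0.
Proof.
have b_free : free b by exact: basis_free (vbasisP _).
move=> u0; apply/rowP => i; rewrite mxE.
have := coord_sum_free (fun i => u 0 i) i b_free.
by rewrite (_ : \sum_(j < _) _ = 0) // linear0.
Qed.

Let vec0 : vec 0 = 0.
Proof. by rewrite /vec big1 // => i _; rewrite mxE scale0r. Qed.

Let f_vec u : f (vec u) = vec (u *m endo_mx).
Proof.
have f0 : f 0 = 0.
  by apply: (addrI (f 0)); rewrite -{1}[f 0]scale1r -f_lin scale1r !addr0.
have -> : f (vec u) = \sum_i u 0 i *: f b`_i.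
  rewrite /vec; elim/big_rec2: _ => [|i _ w _ <-]; first exact: f0.
  exact: f_lin.
rewrite /vec; under [RHS]eq_bigr => j _ do rewrite mxE scaler_suml.
rewrite exchange_big /=; apply: eq_bigr => i _.
rewrite {1}(coord_vbasis (memvf (f b`_i))) scaler_sumr.
by apply: eq_bigr => j _; rewrite !mxE scalerA.
Qed.

Lemma det_endo_eq0 : \det endo_mx = 0 -> exists2 v, v != 0 & f v = 0.
Proof.
move=> /eqP/det0P[u u0 uM]; exists (vec u); last by rewrite f_vec uM vec0.
by apply: contraNneq u0 => /vec_eq0->.
Qed.

Lemma det_endo_neq0 : \det endo_mx != 0 ->
  (forall v, f v = 0 -> v = 0) /\ (forall w, exists v, f v = w).
Proof.
move=> detM; have M_unit : endo_mx \in unitmx by rewrite unitmxE unitfE.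
split=> [v|w].
  have [u ->] := vec_surj v; rewrite f_vec => /vec_eq0.
  move=> /(congr1 (mulmx^~ (invmx endo_mx))).
  by rewrite mulmxK // mul0mx => ->; rewrite vec0.
have [u ->] := vec_surj w; exists (vec (u *m invmx endo_mx)).
by rewrite f_vec mulmxKV.
Qed.

End EndomorphismMatrix.

Section AlgebraZeroDivisors.
Variables (F : fieldType) (R : fdAlgebraType F).
Implicit Types x y : R.

Local Notation d := (\dim {:R}).

(* The matrix of [(y, z) |-> (x y, z x)]. *)
Definition mult_mx x : 'M[F]_(d + d) :=
  block_mx (endo_mx (rngmul x)) 0 0 (endo_mx (rngmul^~ x)).

Let lmul_lin x a y z : x ** (a *: y + z) = a *: (x ** y) + x ** z.
Proof. by rewrite rngmulDr rngscaleAr. Qed.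

Let rmul_lin x a y z : (a *: y + z) ** x = a *: (y ** x) + z ** x.
Proof. by rewrite rngmulDl rngscaleAl. Qed.

Lemma mult_mx_functional i j : functional (fun x => mult_mx x i j).
Proof.
move=> a x y; rewrite /mult_mx.
have [i' ->|i' ->] := split_ordP i; have [j' ->|j' ->] := split_ordP j.
- by rewrite !block_mxEul !mxE rmul_lin linearP.
- by rewrite !block_mxEur !mxE mulr0 addr0.
- by rewrite !block_mxEdl !mxE mulr0 addr0.
- by rewrite !block_mxEdr !mxE lmul_lin linearP.
Qed.

Lemma det_mult_mx x :
  \det (mult_mx x) = \det (endo_mx (rngmul x)) * \det (endo_mx (rngmul^~ x)).
Proof. exact: det_ublock. Qed.

Lemma det_mult_mx0 x : \det (mult_mx x) = 0 -> zero_divisor x.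
Proof.
rewrite det_mult_mx => /eqP; rewrite mulf_eq0 => /orP[] /eqP.
  move=> /(det_endo_eq0 (lmul_lin x))[v v0 xv0] /(_ _ v0)[].
  by rewrite xv0 eqxx.
move=> /(det_endo_eq0 (rmul_lin x))[v v0 vx0] /(_ _ v0)[_].
by rewrite vx0 eqxx.
Qed.

Definition regular x := \det (mult_mx x) != 0.

(** Both multiplications by a regular [x] are bijective. A solution [e] of [x e = x] is a left unit,
    as [x (e y - y) = 0]; symmetrically [e'] is a right unit, and the two agree. Surjectivity for
    any regular element then gives its inverse. *)
Lemma regular_unital : (exists x, regular x) -> exists (e : R) (inv : R -> R),
  [/\ forall x, e ** x = x, forall x, x ** e = x,
      forall x, regular x -> inv x ** x = e &
      forall x, regular x -> x ** inv x = e].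
Proof.
have regP x : regular x ->
    [/\ forall y, x ** y = 0 -> y = 0, forall y, y ** x = 0 -> y = 0,
        forall z, exists y, x ** y = z & forall z, exists y, y ** x = z].
  rewrite /regular det_mult_mx mulf_eq0 negb_or => /andP[].
  move=> /(det_endo_neq0 (lmul_lin x))[? ?] /(det_endo_neq0 (rmul_lin x))[? ?].
  by split.
move=> [x /regP[x_injl x_injr x_surjl x_surjr]].
have [e xe] := x_surjl x; have [e' e'x] := x_surjr x.
have mul1e y : e ** y = y.
  apply/eqP; rewrite -subr_eq0; apply/eqP/x_injl.
  by rewrite rngmulBr rngmulA xe subrr.
have mule'1 y : y ** e' = y.
  apply/eqP; rewrite -subr_eq0; apply/eqP/x_injr.
  by rewrite rngmulBl -rngmulA e'x subrr.
have ee' : e' = e by rewrite -[LHS]mul1e mule'1.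
have mule1 y : y ** e = y by rewrite -ee' mule'1.
have /choice[inv invP] y : exists z, regular y -> z ** y = e /\ y ** z = e.
  have [reg_y|_] := boolP (regular y); last by exists 0.
  have [_ _ /(_ e)[r yr] /(_ e)[l ly]] := regP _ reg_y.
  have lr : l = r by rewrite -[l]mule1 -yr rngmulA ly mul1e.
  by exists l; split=> //; rewrite lr.
by exists e, inv; split=> // y /invP[].
Qed.

End AlgebraZeroDivisors.

(** * The characteristic and the growth of the constants *)

Lemma fact_neq0 (F : fieldType) m p0 : (m < p0)%N ->
  ([pchar F] =i pred0 \/ exists2 p : nat, p \in [pchar F] & (p0 <= p)%N) ->
  m`!%:R != 0 :> F.
Proof.
move=> lt_m char_F; suff nat_neq0 j : (0 < j <= m)%N -> j%:R != 0 :> F.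
  elim: m {lt_m} nat_neq0 => [|m IH] nat_neq0; first by rewrite oner_eq0.
  rewrite factS natrM mulf_neq0 //; first by rewrite nat_neq0 /=.
  by apply: IH => j /andP[j_gt0 le_j]; rewrite nat_neq0 // j_gt0 ltnW.
move=> /andP[j_gt0 le_j]; case: char_F => [/pcharf0P->|[p char_p le_p]].
  by rewrite -lt0n.
rewrite -(dvdn_pcharf char_p); apply/negP => /(dvdn_leq j_gt0); lia.
Qed.

(** This expresses a bound [K^O(1)]; the base [k.+1] allows positive values at [k = 0]. *)
Definition poly_bounded (f : nat -> nat) :=
  exists c e, forall k, (f k <= c * k.+1 ^ e)%N.

Lemma poly_bounded_const c : poly_bounded (fun=> c).
Proof. by exists c, 0%N => k; rewrite muln1. Qed.

Lemma poly_bounded_id : poly_bounded id.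
Proof. by exists 1%N, 1%N => k; rewrite mul1n expn1. Qed.

Lemma poly_boundedM f g : poly_bounded f -> poly_bounded g ->
  poly_bounded (fun k => f k * g k)%N.
Proof.
move=> [c [e fP]] [c' [e' gP]]; exists (c * c')%N, (e + e')%N => k.
by rewrite expnD mulnACA leq_mul.
Qed.

Lemma leq_expn i j k : (i <= j)%N -> (i ^ k <= j ^ k)%N.
Proof. by case: k => // k le_ij; rewrite leq_exp2r. Qed.

Lemma poly_bounded_comp f g : poly_bounded f -> poly_bounded g ->
  poly_bounded (fun k => g (f k)).
Proof.
move=> [c [e fP]] [c' [e' gP]]; exists (c' * c.+1 ^ e')%N, (e * e')%N => k.
apply: leq_trans (gP _) _; rewrite -mulnA leq_mul2l expnM -expnMn leq_expn ?orbT //.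
by rewrite mulSn -addn1 addnC leq_add ?expn_gt0.
Qed.

Lemma poly_boundedX f i : poly_bounded f -> poly_bounded (fun k => f k ^ i)%N.
Proof.
move=> fP; elim: i => [|i IH]; first exact: poly_bounded_const.
under eq_fun do rewrite expnS.
exact: poly_boundedM.
Qed.

Lemma poly_bounded_dense_const D : poly_bounded (dense_const D).
Proof.
elim: D => [|D IH]; first exact: poly_bounded_const.
apply: (@poly_boundedM (fun L => 2 * L)%N).
  exact: poly_boundedM (poly_bounded_const 2) poly_bounded_id.
apply: (@poly_bounded_comp (fun L => 2 * L ^ 2)%N) IH.
by apply: poly_boundedM; [exact: poly_bounded_const|exact: poly_boundedX poly_bounded_id].
Qed.

Lemma poly_bounded_density_loss D L k : poly_bounded L ->
  poly_bounded (fun K => density_loss D (L K) k).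
Proof.
move=> LP; elim: k => [|k IH]; first exact: poly_bounded_const.
apply: poly_boundedM => //.
apply: (@poly_bounded_comp (fun K => L K * density_loss D (L K) k)%N).
  exact: poly_boundedM.
exact: poly_bounded_dense_const.
Qed.

Definition bad_pairs_loss K := (256 * K ^ 4 * closure_const K)%N.

Lemma poly_bounded_bad_pairs_loss : poly_bounded bad_pairs_loss.
Proof.
have idP := poly_bounded_id; have cst := poly_bounded_const.
have step f : poly_bounded f -> poly_bounded (fun K => f K * (f K * f K) * K ^ 5)%N.
  by move=> fP; repeat apply: poly_boundedM => //; exact: poly_boundedX.
apply: poly_boundedM; first by apply: poly_boundedM => //; exact: poly_boundedX.
apply: (step); apply: (step).
apply: (@poly_boundedM (fun K => 2 * K ^ 3 * (2 * K ^ 3))%N); last exact: poly_boundedX.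
by apply: (@poly_boundedM (fun K => 2 * K ^ 3)%N (fun K => 2 * K ^ 3)%N);
  apply: poly_boundedM => //; exact: poly_boundedX.
Qed.

(** The first factor is lost in passing from [A] to the [a] with [a - c] not regular, and multiplies
    the bound [K ^ 2] on [|A - A| / |A|]. [d + d] is the size of [mult_mx], and [d] the number of
    dimensions that can be given up. *)
Definition zero_divisor_loss d K :=
  (bad_pairs_loss K * density_loss (d + d) (K ^ 2 * bad_pairs_loss K) d)%N.

Lemma poly_bounded_zero_divisor_loss d : poly_bounded (zero_divisor_loss d).
Proof.
apply: poly_boundedM; first exact: poly_bounded_bad_pairs_loss.
apply: poly_bounded_density_loss; apply: poly_boundedM.
  exact: poly_boundedX poly_bounded_id.
exact: poly_bounded_bad_pairs_loss.
Qed.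

Lemma bad_pairs_loss_ge2 K : (0 < K)%N -> (2 <= bad_pairs_loss K)%N.
Proof.
move=> K_gt0; rewrite /bad_pairs_loss -mulnA; apply: (@leq_trans (256 * 1)) => //.
rewrite leq_mul2l muln_gt0 expn_gt0 K_gt0 /= /closure_const /quotient_const.
by rewrite !(muln_gt0, expn_gt0) K_gt0.
Qed.

(** * The dichotomy for an integer [K] *)

Section Dichotomy.
Variables (F : fieldType) (R : fdAlgebraType F) (A : {fset R}) (K : nat).

Local Notation d := (\dim {:R}).
Local Notation n := #|` A|.

Hypothesis K_gt0 : (0 < K)%N.
Hypothesis A_neq0 : A != fset0.
Hypothesis doublingA : (#|` A :+: A| <= K * n)%N.
Hypothesis productA : (#|` prodset A A| <= K * n)%N.
Hypothesis fact_dd : (d + d)`!%:R != 0 :> F.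

Let n_gt0 : (0 < n)%N. Proof. by rewrite cardfs_gt0. Qed.

Lemma many_zero_divisors c :
  (n <= bad_pairs_loss K * #|` [fset a in A | ~~ regular (a - c)%R]|)%N ->
  exists V : {vspace R}, (forall v, v \in V -> zero_divisor v) /\
    exists x, (n <= zero_divisor_loss d K * #|` inter_affine A x V|)%N.
Proof.
set Z := [fset a in A | _] => leZ; pose B := Z :+: [fset - c].
have cardB : #|` B| = #|` Z| by exact: card_translate.
have Z_neq0 : Z != fset0.
  by apply: contraTneq leZ => ->; rewrite cardfs0 muln0 -ltnNge.
have diffB : (#|` B :-: B| <= K ^ 2 * bad_pairs_loss K * #|` B|)%N.
  rewrite cardB -mulnA; apply: (@leq_trans (K ^ 2 * n)); last first.
    by rewrite leq_mul2l leZ orbT.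
  apply: leq_trans (plunnecke_ruzsa 0 0 A_neq0 doublingA).
  apply/fsubset_leq_card/fsubsetP => z /subfsP[v [w []]].
  move=> /addfsP[a [x [aZ /[!in_fset1]/eqP-> ->]]].
  move=> /addfsP[b [y [bZ /[!in_fset1]/eqP-> ->]]] -> {z v w}.
  rewrite opprD addrACA subrr addr0 mem_subfs //.
    by move: aZ; rewrite !inE => /andP[].
  by move: bZ; rewrite !inE => /andP[].
have detB : {in B, forall b, \det (mult_mx b) = 0}.
  move=> _ /addfsP[a [x [aZ /[!in_fset1]/eqP-> ->]]].
  by move: aZ; rewrite !inE negbK => /andP[_ /eqP].
have B_neq0 : B != fset0 by rewrite -cardfs_gt0 cardB cardfs_gt0.
have [V [x [V0 leV]]] := concentrated_zeros
  (@mult_mx_functional F R) fact_dd B_neq0 diffB detB.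
(* Adding [c] undoes the translation from [Z] to [B]. *)
exists V; split=> [v /V0/det_mult_mx0//|]; exists (x + c).
apply: leq_trans leZ _; rewrite /zero_divisor_loss -mulnA leq_mul2l -cardB.
apply/orP; right; apply: leq_trans leV _; rewrite leq_mul2l; apply/orP; right.
apply: (@leq_card_fset_inj _ _ _ _ (+%R^~ c)) => [y z _ _|b]; first exact: addIr.
rewrite !inE => /andP[/addfsP[a [y [aZ /[!in_fset1]/eqP-> ->]]] bV].
rewrite subrK; move: aZ; rewrite !inE => /andP[-> _] /=.
by rewrite opprD addrA addrAC.
Qed.

Lemma dichotomy :
  (exists V : {vspace R}, (forall v, v \in V -> zero_divisor v) /\
    exists x, (n <= zero_divisor_loss d K * #|` inter_affine A x V|)%N) \/
  (exists A' : {fset R}, [/\ A' `<=` A, (n <= 4 * K * #|` A'|)%N &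
     exists (R0 : finRngType) (phi : rngAut R0) (iota : nat -> R -> twpoly phi),
       graded_embedding A' iota]).
Proof.
(* [Z 0] collects the zero divisors in [A] itself, and the [Z c] with [c] in [A] the pairs whose
   difference is a zero divisor. *)
pose Z c := [fset a in A | ~~ regular (a - c)%R].
have [[c /many_zero_divisors]|few] :=
  pselect (exists c, (n <= bad_pairs_loss K * #|` Z c|)%N); first by left.
right.
have fewZ c : (bad_pairs_loss K * #|` Z c| < n)%N.
  by rewrite ltnNge; apply/negP => le_c; apply: few; exists c.
have many_units : (n <= 2 * #|` [fset a in A | regular a]|)%N.
  have split_card : (#|` [fset a in A | regular a]| + #|` Z 0%R| = n)%N.
    rewrite /Z !card_fset_sep -big_split card_fset_sum1 /=.
    by apply: eq_bigr => a _; rewrite subr0; case: (regular a).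
  have : (2 * #|` Z 0%R| <= n)%N.
    apply: leq_trans (ltnW (fewZ 0)); rewrite leq_mul2r; apply/orP; right.
    exact: bad_pairs_loss_ge2.
  by move: split_card; set z := #|` Z 0%R|; set r := #|` _| => <-; lia.
have few_bad : (bad_pairs_loss K *
    #|` [fset p in A `*` A | ~~ regular (p.1 - p.2)%R]| < n ^ 2)%N.
  rewrite card_fset_sep sum_fsetX exchange_big /= big_distrr /=.
  apply: (@leq_ltn_trans (\sum_(c <- A) n.-1)).
    apply: leq_sum => c _; rewrite -card_fset_sep -ltnS prednK //; exact: fewZ.
  by rewrite sum_fset_const -mulnn ltn_pmul2l // prednK.
have [|e [inv [mul1e mule1 mulVu muluV]]] := @regular_unital F R.
  have /fset0Pn[a] : [fset a in A | regular a] != fset0.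
    by rewrite -cardfs_gt0; move: many_units n_gt0; lia.
  by rewrite inE => /andP[_]; exists a.
have [b [A1 [S [reg_b A1A leA1 S_ring [S_conj A1S]]]]] := invariant_subring
  K_gt0 A_neq0 doublingA productA mul1e mule1 mulVu muluV many_units few_bad.
exists A1; split=> //.
have [a aA1] : exists a, a \in A1.
  apply/fset0Pn; apply: contraTneq leA1 => ->.
  by rewrite cardfs0 muln0 -ltnNge.
have S0 : 0 \in S by rewrite -(subrr (a ** inv b)) (S_ring _ _ _ _).1 ?A1S.
apply: (twisted_embedding mul1e mule1 (muluV _ reg_b) (mulVu _ reg_b) S0 _ _ S_conj A1S).
  by move=> x y xS yS; exact: (S_ring _ _ xS yS).1.
by move=> x y xS yS; exact: (S_ring _ _ xS yS).2.
Qed.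

End Dichotomy.

(* C and e are the absolute constants of (ii); Cd and ed are the constants of
   (i), and p0 is the threshold on the characteristic, all depending on d. *)
Theorem theorem5p8 (RR : realType) :
  exists (C : RR) (e : nat), 0 < C /\
  forall d : nat, exists (Cd : RR) (ed p0 : nat), 0 < Cd /\
  forall (F : fieldType) (R : fdAlgebraType F) (A : {fset R}) (K : RR),
    \dim {: R} = d ->
    ([pchar F] =i pred0 \/ exists2 p : nat, p \in [pchar F] & (p0 <= p)%N) ->
    A != fset0 ->
    1 <= K ->
    #|` sumset A A|%:R <= K * #|` A|%:R ->
    #|` prodset A A|%:R <= K * #|` A|%:R ->
    (exists V : {vspace R},
       (forall v : R, v \in V -> zero_divisor v) /\
       exists x : R,
         K ^- ed * #|` A|%:R <= Cd * #|` [fset a in A | a - x \in V]|%:R)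
    \/
    (exists A' : {fset R},
       [/\ A' `<=` A,
           K ^- e * #|` A|%:R <= C * #|` A'|%:R &
           exists (R0 : finRngType) (phi : rngAut R0)
                  (iota : nat -> R -> twpoly phi),
             graded_embedding A' iota]).
Proof.
(* [8] is the [4] of [dichotomy] times the [2] lost in rounding [K] up to an integer [k <= 2 K]. *)
exists 8, 1%N; split=> // d.
have [c [ed lossP]] := poly_bounded_zero_divisor_loss d.
(* [3] comes from [k.+1 <= 3 K], and [c.+1] is positive even if [c = 0]. A characteristic above
   [2 d] keeps [(2 d)!] nonzero in [F]. *)
exists (c.+1 * 3 ^ ed)%:R, ed, (d + d).+1; split.
  by rewrite ltr0n muln_gt0 expn_gt0.
move=> F R A K dimR char_F A0 K_ge1 sumA prodA.
have K_gt0 : 0 < K by exact: lt_le_trans K_ge1.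
pose k := (Num.truncn K).+1.
have [leKk lekK] : K <= k%:R /\ k%:R <= 2 * K.
  have /andP[le_tr lt_tr] := truncn_itv (ltW K_gt0).
  split; first exact: ltW.
  by rewrite /k -addn1 natrD; lra.
have to_nat m : m%:R <= K * #|` A|%:R -> (m <= k * #|` A|)%N.
  move=> le_m; rewrite -(ler_nat RR) natrM; apply: le_trans le_m _.
  by rewrite ler_wpM2r.
have fact_dd : (\dim {:R} + \dim {:R})`!%:R != 0 :> F.
  by rewrite dimR; exact: fact_neq0 char_F.
have [[V [V0 [x le_x]]]|[A' [A'A leA' emb]]] :=
  dichotomy (isT : 0 < k)%N A0 (to_nat _ sumA) (to_nat _ prodA) fact_dd.
- left; exists V; split=> //; exists x.
  rewrite ler_pdivrMl ?exprn_gt0 //.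
  apply: (@le_trans _ _ ((c.+1 * k.+1 ^ ed * #|` inter_affine A x V|)%N)%:R).
    rewrite ler_nat; apply: leq_trans le_x _; rewrite leq_mul2r dimR.
    by rewrite (leq_trans (lossP k)) ?orbT // leq_mul2r leqnSn orbT.
  rewrite mulrA natrM; apply: ler_wpM2r => //.
  rewrite !natrM mulrCA; apply: ler_wpM2l => //.
  rewrite !natrX -exprMn lerXn2r ?nnegrE ?mulr_ge0 ?(ltW K_gt0) //.
  by rewrite -addn1 natrD; lra.
- right; exists A'; split=> //.
  rewrite expr1 ler_pdivrMl //.
  move: leA'; rewrite -(ler_nat RR) !natrM => /le_trans; apply.
  rewrite mulrA; apply: ler_wpM2r => //.
  by rewrite mulrC; lra.
Qed.
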